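(* The functor $\mathcal{T}:\mathbf{SMLaw}\to\mathbf{CMnd}$, $\mathbf{L}\mapsto T_{\mathbf L}$, restricts to a functor $\mathbf{SMBLaw}\to\mathbf{ACMnd}$. Further, this restriction is left adjoint to the finitary Kleisli construction $\mathcal{K}\ell_{\mathbb N}:\mathbf{ACMnd}\to\mathbf{SMBLaw}$.
   Context: Monads on $\mathbf{Sets}$. Each monad $T$ on $\mathbf{Sets}$ has a canonical strength $\mathsf{st}:T(X)\times Y\to T(X\times Y)$, $\mathsf{st}(u,y)=T(\lambda x.(x,y))(u)$; let $\mathsf{st}'=T(\gamma)\circ\mathsf{st}\circ\gamma$ with $\gamma$ the swap. $T$ is commutative if $\mu\circ T(\mathsf{st}')\circ\mathsf{st}=\mu\circ T(\mathsf{st})\circ\mathsf{st}'$; this map is then $\mathsf{dst}:T(X)\times T(Y)\to T(X\times Y)$. If $T(0)\cong1$, the zero map is $0_{X,Y}=(X\to1\cong T(0)\xrightarrow{T(!)}T(Y))$, $p_1=[\eta,0_{Y,X}]:X+Y\to T(X)$, $p_2=[0_{X,Y},\eta]:X+Y\to T(Y)$, $\mathsf{bc}=\langle\mu\circ T(p_1),\mu\circ T(p_2)\rangle:T(X+Y)\to T(X)\times T(Y)$. $T$ is additive if $T(0)\cong1$ and all $\mathsf{bc}$ are isomorphisms. $\mathbf{CMnd}$ and $\mathbf{ACMnd}$ are the categories of commutative, respectively additive and commutative, monads on $\mathbf{Sets}$, with monad maps as morphisms. Lawvere theories. Let $\underline{n}=\{0,\ldots,n-1\}$. $\aleph_0$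 has natural numbers as objects and functions $\underline n\to\underline m$ as morphisms; $(+,0)$ gives finite coproducts. A Lawvere theory is a small category $\mathbf{L}$ with natural numbers as objects together with a functor $\aleph_0\to\mathbf{L}$ that is the identity on objects and strictly preserves finite coproducts; morphisms are identity-on-objects functors strictly preserving finite coproducts. $\aleph_0$ has a symmetric monoidal structure: $n\otimes m=n\times m$ (multiplication), unit $1$, $f\otimes g=\mathsf{co}^{-1}\circ(f\times g)\circ\mathsf{co}$ where $\mathsf{co}:\underline{n\times m}\to\underline n\times\underline m$ is the bijection with $\mathsf{co}(c)=(a,b)\iff c=a\cdot m+b$, and the monoidal isomorphisms are transported from $(\mathbf{Sets},\times,1)$ along $\mathsf{co}$. $\mathbf{SMLaw}$: Lawvere theories with a symmetric monoidal structure strictly preserved by $\aleph_0\to\mathbf{L}$; morphisms are Lawvere theory morphisms strictly preserving the tensor structure. $\mathbf{SMBLaw}$: objects of $\mathbf{SMLaw}$ in which $(+,0)$ forms not only coproducts but biproducts, i.e. $0$ is a zero object and each $n+m$ is also a product with projections satisfying $\pi_j\circ\kappa_i=\mathrm{id}$ if $i=j$ and $\pi_j\circ\kappa_i=0$ (zero map) if $i\ne j$ (so $\pi_1=[\mathrm{id},0]$, $\pi_2=[0,\mathrm{id}]$); morphisms are functors strictly preserving all the structure. Functor $\mathcal{K}\ell_{\mathbb N}$: $\mathcal{K}\ell_{\mathbb{N}}(T)$ has natural numbers as objects, functions $\underline n\to T(\underline m)$ as morphisms $n\to m$, Kleisli composition, coproducts from $\mathbf{Sets}$; a monad map $\sigma$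 acts by $f\mapsto\sigma\circ f$. For $T$ commutative, the tensor of $f:n\to p$, $g:m\to q$ is $T(\mathsf{co}^{-1})\circ\mathsf{dst}\circ(f\times g)\circ\mathsf{co}$. For $T$ additive the coproducts are biproducts. Functor $\mathcal{T}$: $T_{\mathbf L}(X)=\big(\coprod_{i\in\mathbb N}\mathbf{L}(1,i)\times X^i\big)/\!\sim$, with $\sim$ the least equivalence relation such that $\kappa_m(f\circ g,v)\sim\kappa_i(g,v\circ f)$ for $f:i\to m$ in $\aleph_0$, $g\in\mathbf{L}(1,i)$, $v\in X^m$. $T_{\mathbf L}(h)[\kappa_i(g,v)]=[\kappa_i(g,h\circ v)]$; unit $x\mapsto[\kappa_1(\mathrm{id}_1,x)]$; multiplication $\mu([\kappa_i(g,v)])=[\kappa_j((g_0+\cdots+g_{i-1})\circ g,[v_0,\ldots,v_{i-1}])]$, where $v(a)=[\kappa_{j_a}(g_a,v_a)]$ for $a<i$ and $j=j_0+\cdots+j_{i-1}$. A morphism $F$ is sent to $[\kappa_i(g,v)]\mapsto[\kappa_i(F(g),v)]$. For $\mathbf{L}\in\mathbf{SMLaw}$ the monad $T_{\mathbf L}$ is commutative. *)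

(* Defs.v *)
From mathcomp Require Import all_boot order.
From mathcomp Require Import boolp.
From Stdlib Require Import Relation_Operators Operators_Properties.

Set Implicit Arguments.
Unset Strict Implicit.
Unset Printing Implicit Defensive.

Declare Scope cat_scope.
Open Scope cat_scope.

Record category := Category {
  obj :> Type;
  hom : obj -> obj -> Type;
  idc : forall A, hom A A;
  compc : forall A B C, hom B C -> hom A B -> hom A C;
  compc1 : forall A B (f : hom A B), compc f (idc A) = f;
  comp1c : forall A B (f : hom A B), compc (idc B) f = f;
  compcA : forall A B C D (h : hom C D) (g : hom B C) (f : hom A B),
    compc h (compc g f) = compc (compc h g) f }.

Arguments idc {c} A.
Notation "g \oc f" := (compc g f) (at level 50, left associativity) : cat_scope.

Record functor (C D : category) := Functor {
  fobj :> C -> D;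
  farr : forall A B : C, hom A B -> hom (fobj A) (fobj B);
  farr1 : forall A : C, farr (idc A) = idc (fobj A);
  farrM : forall (A B E : C) (g : hom B E) (f : hom A B),
    farr (g \oc f) = farr g \oc farr f }.

Arguments farr {C D} F {A B} f : rename.

Lemma functor_comp_id (C D E : category) (G : functor D E) (F : functor C D)
  (A : C) : farr G (farr F (idc A)) = idc (G (F A)).
Proof. by rewrite !farr1. Qed.

Lemma functor_comp_comp (C D E : category) (G : functor D E) (F : functor C D)
    (A B X : C) (g : hom B X) (f : hom A B) :
  farr G (farr F (g \oc f)) = farr G (farr F g) \oc farr G (farr F f).
Proof. by rewrite !farrM. Qed.

Definition functor_comp (C D E : category) (G : functor D E) (F : functor C D) :
    functor C E :=
  @Functor C E (fun A => G (F A)) (fun A B f => farr G (farr F f))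
    (functor_comp_id G F) (functor_comp_comp G F).

Definition is_left_adjoint (C D : category) (F : functor C D) (G : functor D C) :
    Prop :=
  exists phi : forall (A : C) (B : D), hom (F A) B -> hom A (G B),
    (forall A B, bijective (@phi A B)) /\
    (forall (A A' : C) (B B' : D) (h : hom A' A) (k : hom B B') (f : hom (F A) B),
       phi A' B' (k \oc f \oc farr F h) = farr G k \oc phi A B f \oc h).

(* A single universe level: monads are endofunctors of the category of [Sets],
   and the hom-sets of a (small) Lawvere theory live in [Sets]. *)
Definition Sets := Type.

Record monad := Monad {
  mfun :> Sets -> Sets;
  fmap : forall X Y : Sets, (X -> Y) -> mfun X -> mfun Y;
  ret : forall X : Sets, X -> mfun X;
  join : forall X : Sets, mfun (mfun X) -> mfun X;
  fmap_id : forall (X : Sets) (t : mfun X), fmap id t = t;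
  fmap_comp : forall (X Y Z : Sets) (g : Y -> Z) (f : X -> Y) (t : mfun X),
    fmap (g \o f) t = fmap g (fmap f t);
  ret_nat : forall (X Y : Sets) (f : X -> Y) (x : X), fmap f (ret x) = ret (f x);
  join_nat : forall (X Y : Sets) (f : X -> Y) (t : mfun (mfun X)),
    fmap f (join t) = join (fmap (fmap f) t);
  join_join : forall (X : Sets) (t : mfun (mfun (mfun X))),
    join (join t) = join (fmap (@join X) t);
  join_ret : forall (X : Sets) (t : mfun X), join (ret t) = t;
  join_fmap_ret : forall (X : Sets) (t : mfun X), join (fmap (@ret X) t) = t }.

Arguments fmap {m X Y} f t : rename.
Arguments ret {m X} x : rename.
Arguments join {m X} t : rename.

Record monad_map (S T : monad) := MonadMap {
  mmap :> forall X : Sets, S X -> T X;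
  mmap_nat : forall (X Y : Sets) (f : X -> Y) (t : S X),
    mmap (fmap f t) = fmap f (mmap t);
  mmap_ret : forall (X : Sets) (x : X), mmap (ret x) = ret x;
  mmap_join : forall (X : Sets) (t : S (S X)),
    mmap (join t) = join (fmap (@mmap X) (mmap t)) }.

Arguments mmap {S T} s {X} t : rename.

Lemma monad_map_ext (S T : monad) (s s' : monad_map S T) :
  (forall (X : Sets) (t : S X), mmap s t = mmap s' t) -> s = s'.
Proof.
case: s s' => [s s1 s2 s3] [s' s1' s2' s3'] /= e.
have E : s = s' by apply: functional_extensionality_dep => X; apply: funext => t.
by subst s'; congr MonadMap; apply: Prop_irrelevance.
Qed.

Section MonadMapCategory.

Lemma monad_map_id_join (T : monad) (X : Sets) (t : T (T X)) :
  join t = join (fmap id t).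
Proof. by rewrite fmap_id. Qed.

Definition monad_map_id (T : monad) : monad_map T T :=
  @MonadMap T T (fun X t => t) (fun _ _ _ _ => erefl) (fun _ _ => erefl)
    (@monad_map_id_join T).

Variables (S T U : monad) (s' : monad_map T U) (s : monad_map S T).
Let c (X : Sets) (t : S X) : U X := mmap s' (mmap s t).

Lemma monad_map_comp_nat (X Y : Sets) (f : X -> Y) (t : S X) :
  c (fmap f t) = fmap f (c t).
Proof. by rewrite /c !mmap_nat. Qed.

Lemma monad_map_comp_ret (X : Sets) (x : X) : c (ret x) = ret x.
Proof. by rewrite /c !mmap_ret. Qed.

Lemma monad_map_comp_join (X : Sets) (t : S (S X)) :
  c (join t) = join (fmap (@c X) (c t)).
Proof. by rewrite /c !mmap_join -mmap_nat -fmap_comp !mmap_nat. Qed.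

Definition monad_map_comp : monad_map S U :=
  MonadMap monad_map_comp_nat monad_map_comp_ret monad_map_comp_join.

End MonadMapCategory.

Definition swap_pair (X Y : Sets) (p : X * Y) : Y * X := (p.2, p.1).

Definition st (T : monad) (X Y : Sets) (p : T X * Y) : T (X * Y)%type :=
  fmap (fun x => (x, p.2)) p.1.

Definition st' (T : monad) (X Y : Sets) : X * T Y -> T (X * Y)%type :=
  fmap (@swap_pair Y X) \o @st T Y X \o @swap_pair X (T Y).

Definition dst (T : monad) (X Y : Sets) : T X * T Y -> T (X * Y)%type :=
  join \o fmap (@st' T X Y) \o @st T X (T Y).

Definition commutative_monad (T : monad) : Prop :=
  forall (X Y : Sets) (p : T X * T Y),
    join (fmap (@st' T X Y) (st p)) = join (fmap (@st T X Y) (st' p)).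

Record cmonad := CMonad {
  cmonad_monad :> monad;
  cmonadP : commutative_monad cmonad_monad }.

Definition CMnd : category.
refine (@Category cmonad (fun S T => monad_map S T) (fun T => monad_map_id T)
  (fun S T U s' s => monad_map_comp s' s) _ _ _).
- by move=> S T s; apply: monad_map_ext.
- by move=> S T s; apply: monad_map_ext.
- by move=> S T U V s s' s''; apply: monad_map_ext.
Defined.

Section Additive.

(* [z] stands for the unique element of [T 0], see [additive_monad]. *)
Variables (T : monad) (z : T void).

Definition zero_map (X Y : Sets) : X -> T Y :=
  fun=> fmap (fun v : void => match v with end) z.

Definition copr1 (X Y : Sets) (s : X + Y) : T X :=
  match s with inl x => ret x | inr y => zero_map X y end.

Definition copr2 (X Y : Sets) (s : X + Y) : T Y :=
  match s with inl x => zero_map Y x | inr y => ret y end.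

Definition bc (X Y : Sets) (t : T (X + Y)%type) : T X * T Y :=
  (join (fmap (@copr1 X Y) t), join (fmap (@copr2 X Y) t)).

End Additive.

Definition additive_monad (T : monad) : Prop :=
  exists z : T void,
    (forall t : T void, t = z) /\ (forall X Y : Sets, bijective (@bc T z X Y)).

Record acmonad := ACMonad {
  acmonad_cmonad :> cmonad;
  acmonadP : additive_monad acmonad_cmonad }.

Definition ACMnd : category :=
  @Category acmonad (fun S T => @hom CMnd S T) (fun T => @idc CMnd T)
    (fun S T U => @compc CMnd S T U) (fun S T => @compc1 CMnd S T)
    (fun S T => @comp1c CMnd S T) (fun S T U V => @compcA CMnd S T U V).

Definition incl_ACMnd : functor ACMnd CMnd :=
  @Functor ACMnd CMnd acmonad_cmonad (fun _ _ s => s) (fun=> erefl)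
    (fun _ _ _ _ _ => erefl).

Record natcat := NatCat {
  nhom : nat -> nat -> Sets;
  nid : forall n, nhom n n;
  ncomp : forall n m p, nhom m p -> nhom n m -> nhom n p;
  ncomp1 : forall n m (f : nhom n m), ncomp f (nid n) = f;
  n1comp : forall n m (f : nhom n m), ncomp (nid m) f = f;
  ncompA : forall n m p q (h : nhom p q) (g : nhom m p) (f : nhom n m),
    ncomp h (ncomp g f) = ncomp (ncomp h g) f }.

Arguments nid {n0} n : rename.
Notation "g \on f" := (ncomp g f) (at level 50, left associativity) : cat_scope.

Record natfunctor (C D : natcat) := NatFunctor {
  nmap : forall n m, nhom C n m -> nhom D n m;
  nmap1 : forall n, nmap (nid n) = nid n;
  nmapM : forall n m p (g : nhom C m p) (f : nhom C n m),
    nmap (g \on f) = nmap g \on nmap f }.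

Arguments nmap {C D} F {n m} f : rename.

Section Limits.

Variable C : natcat.

Definition is_initial (z : nat) : Prop :=
  forall n, exists f : nhom C z n, forall g, g = f.

Definition is_terminal (z : nat) : Prop :=
  forall n, exists f : nhom C n z, forall g, g = f.

Definition is_coproduct n m c (k1 : nhom C n c) (k2 : nhom C m c) : Prop :=
  forall p (f : nhom C n p) (g : nhom C m p),
    exists! h : nhom C c p, h \on k1 = f /\ h \on k2 = g.

Definition is_product n m c (p1 : nhom C c n) (p2 : nhom C c m) : Prop :=
  forall k (f : nhom C k n) (g : nhom C k m),
    exists! h : nhom C k c, p1 \on h = f /\ p2 \on h = g.

Definition is_zero n m (f : nhom C n m) : Prop :=
  exists (a : nhom C n 0) (b : nhom C 0 m), f = b \on a.

Definition is_iso n m (f : nhom C n m) : Prop :=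
  exists g : nhom C m n, g \on f = nid n /\ f \on g = nid m.

End Limits.

(* The tensor is multiplication on objects, with unit 1. *)
Record symmon (C : natcat) := SymMon {
  tens : forall n m p q, nhom C n p -> nhom C m q -> nhom C (n * m) (p * q);
  assoc : forall n m p, nhom C (n * m * p) (n * (m * p));
  lunit : forall n, nhom C (1 * n) n;
  runit : forall n, nhom C (n * 1) n;
  braid : forall n m, nhom C (n * m) (m * n);
  tens1 : forall n m, tens (nid n) (nid m) = nid (n * m);
  tensM : forall n m p q r s (f : nhom C n p) (f' : nhom C p r)
      (g : nhom C m q) (g' : nhom C q s),
    tens (f' \on f) (g' \on g) = tens f' g' \on tens f g;
  assoc_iso : forall n m p, is_iso (assoc n m p);
  lunit_iso : forall n, is_iso (lunit n);
  runit_iso : forall n, is_iso (runit n);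
  assoc_nat : forall n m p n' m' p'
      (f : nhom C n n') (g : nhom C m m') (h : nhom C p p'),
    assoc n' m' p' \on tens (tens f g) h = tens f (tens g h) \on assoc n m p;
  lunit_nat : forall n m (f : nhom C n m),
    lunit m \on tens (nid 1) f = f \on lunit n;
  runit_nat : forall n m (f : nhom C n m),
    runit m \on tens f (nid 1) = f \on runit n;
  braid_nat : forall n m p q (f : nhom C n p) (g : nhom C m q),
    braid p q \on tens f g = tens g f \on braid n m;
  braidK : forall n m, braid m n \on braid n m = nid (n * m);
  pentagon : forall n m p q,
    tens (nid n) (assoc m p q) \on assoc n (m * p) q \on tens (assoc n m p) (nid q)
    = assoc n m (p * q) \on assoc (n * m) p q;
  triangle : forall n m,
    tens (nid n) (lunit m) \on assoc n 1 m = tens (runit n) (nid m);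
  hexagon : forall n m p,
    assoc m p n \on braid n (m * p) \on assoc n m p
    = tens (nid m) (braid n p) \on assoc m n p \on tens (braid n m) (nid p) }.

Arguments tens {C} M {n m p q} f g : rename.

Record strict_symmon (C D : natcat) (F : natfunctor C D)
    (M : symmon C) (N : symmon D) : Prop := StrictSymMon {
  strict_tens : forall n m p q (f : nhom C n p) (g : nhom C m q),
    nmap F (tens M f g) = tens N (nmap F f) (nmap F g);
  strict_assoc : forall n m p, nmap F (assoc M n m p) = assoc N n m p;
  strict_lunit : forall n, nmap F (lunit M n) = lunit N n;
  strict_runit : forall n, nmap F (runit M n) = runit N n;
  strict_braid : forall n m, nmap F (braid M n m) = braid N n m }.

Definition aleph0 : natcat :=
  @NatCat (fun n m => 'I_n -> 'I_m) (fun n => id) (fun n m p g f => g \o f)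
    (fun _ _ _ => erefl) (fun _ _ _ => erefl) (fun _ _ _ _ _ _ _ => erefl).

Definition inj1 n m : nhom aleph0 n (n + m) := @lshift n m.
Definition inj2 n m : nhom aleph0 m (n + m) := @rshift n m.

Arguments inj1 : clear implicits.
Arguments inj2 : clear implicits.

Lemma co_subproof1 n m (c : 'I_(n * m)) : c %/ m < n.
Proof.
case: m c => [|m] c; first by case: c => c /=; rewrite muln0.
by rewrite ltn_divLR.
Qed.

Lemma co_subproof2 n m (c : 'I_(n * m)) : c %% m < m.
Proof. by case: m c => [|m] c; [case: c => c /=; rewrite muln0 | rewrite ltn_mod]. Qed.

Lemma unco_subproof n m (a : 'I_n) (b : 'I_m) : a * m + b < n * m.
Proof.
apply: (@leq_trans (a.+1 * m)); last by rewrite leq_mul2r ltn_ord orbT.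
by rewrite mulSn addnC ltn_add2r.
Qed.

(* co c = (a, b) if and only if c = a * m + b, see [coP]. *)
Definition co n m (c : 'I_(n * m)) : 'I_n * 'I_m :=
  (Ordinal (co_subproof1 c), Ordinal (co_subproof2 c)).
Definition unco n m (p : 'I_n * 'I_m) : 'I_(n * m) :=
  Ordinal (unco_subproof p.1 p.2).

Lemma coK n m : cancel (@co n m) (@unco n m).
Proof. by move=> c; apply: val_inj; rewrite /co /unco /= -divn_eq. Qed.

Lemma uncoK n m : cancel (@unco n m) (@co n m).
Proof.
case=> a b; have m0 : 0 < m by apply: leq_trans (ltn_ord b).
congr pair; apply: val_inj => /=; last by rewrite modnMDl modn_small.
by rewrite divnMDl // divn_small // addn0.
Qed.

Lemma coP n m (c : 'I_(n * m)) (a : 'I_n) (b : 'I_m) :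
  co c = (a, b) <-> c = a * m + b :> nat.
Proof.
split=> [e|e]; first by rewrite -[in LHS](coK c) e.
by rewrite (_ : c = unco (a, b)) ?uncoK //; apply: val_inj.
Qed.

Lemma co_ext (Z : Type) n m (f g : 'I_(n * m) -> Z) :
  (forall a b, f (unco (a, b)) = g (unco (a, b))) -> f = g.
Proof. by move=> e; apply: funext => c; rewrite -(coK c); case: (co c). Qed.

Definition tens0 n m p q (f : nhom aleph0 n p) (g : nhom aleph0 m q) :
    nhom aleph0 (n * m) (p * q) :=
  fun c => unco (f (co c).1, g (co c).2).
Definition assoc0 n m p : nhom aleph0 (n * m * p) (n * (m * p)) :=
  fun c => unco ((co (co c).1).1, unco ((co (co c).1).2, (co c).2)).
Definition lunit0 n : nhom aleph0 (1 * n) n := fun c => (co c).2.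
Definition runit0 n : nhom aleph0 (n * 1) n := fun c => (co c).1.
Definition braid0 n m : nhom aleph0 (n * m) (m * n) :=
  fun c => unco (swap_pair (co c)).

Arguments unco : simpl never.

Lemma tens0E n m p q (f : nhom aleph0 n p) (g : nhom aleph0 m q) a b :
  tens0 f g (unco (a, b)) = unco (f a, g b).
Proof. by rewrite /tens0 uncoK. Qed.
Lemma assoc0E n m p (a : 'I_n) (b : 'I_m) (c : 'I_p) :
  assoc0 (unco (unco (a, b), c)) = unco (a, unco (b, c)).
Proof. by rewrite /assoc0 !uncoK. Qed.
Lemma lunit0E n (a : 'I_1) (b : 'I_n) : lunit0 (unco (a, b)) = b.
Proof. by rewrite /lunit0 uncoK. Qed.
Lemma runit0E n (a : 'I_n) (b : 'I_1) : runit0 (unco (a, b)) = a.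
Proof. by rewrite /runit0 uncoK. Qed.
Lemma braid0E n m (a : 'I_n) (b : 'I_m) : braid0 (unco (a, b)) = unco (b, a).
Proof. by rewrite /braid0 uncoK. Qed.

Definition aleph0E := (tens0E, assoc0E, lunit0E, runit0E, braid0E).

Lemma unco_ex n m (c : 'I_(n * m)) : exists a b, c = unco (a, b).
Proof. by exists (co c).1, (co c).2; rewrite -surjective_pairing coK. Qed.

Lemma assoc0_iso n m p : is_iso (@assoc0 n m p).
Proof.
have [g gE] : exists g : 'I_(n * (m * p)) -> 'I_(n * m * p),
    forall a b c, g (unco (a, unco (b, c))) = unco (unco (a, b), c).
  by exists (fun c => unco (unco ((co c).1, (co (co c).2).1), (co (co c).2).2))
    => a b c; rewrite !uncoK.
exists g; split; apply: co_ext => a b.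
  by have [{}a [c ->]] := unco_ex a; rewrite /= assoc0E gE.
by have [{}b [c ->]] := unco_ex b; rewrite /= gE assoc0E.
Qed.

Lemma lunit0_iso n : is_iso (@lunit0 n).
Proof.
exists (fun a => unco (ord0, a)); split.
  by apply: co_ext => a b; rewrite /= lunit0E (ord1 a).
by apply: funext => a; rewrite /= lunit0E.
Qed.

Lemma runit0_iso n : is_iso (@runit0 n).
Proof.
exists (fun a => unco (a, ord0)); split.
  by apply: co_ext => a b; rewrite /= runit0E (ord1 b).
by apply: funext => a; rewrite /= runit0E.
Qed.

Definition aleph0_symmon : symmon aleph0.
refine (@SymMon aleph0 tens0 assoc0 lunit0 runit0 braid0
  _ _ assoc0_iso lunit0_iso runit0_iso _ _ _ _ _ _ _ _).
- by move=> n m; apply: co_ext => a b; rewrite tens0E.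
- by move=> *; apply: co_ext => a b; rewrite /= !tens0E.
- move=> *; apply: co_ext => x c; have [a [b ->]] := unco_ex x.
  by rewrite /= !aleph0E.
- by move=> *; apply: co_ext => a b; rewrite /= !aleph0E.
- by move=> *; apply: co_ext => a b; rewrite /= !aleph0E.
- by move=> *; apply: co_ext => a b; rewrite /= !aleph0E.
- by move=> *; apply: co_ext => a b; rewrite /= !aleph0E.
- move=> *; apply: co_ext => x d; have [{}x [c ->]] := unco_ex x.
  by have [a [b ->]] := unco_ex x; rewrite /= !aleph0E.
- move=> *; apply: co_ext => x c; have [a [b ->]] := unco_ex x.
  by rewrite /= !aleph0E.
- move=> *; apply: co_ext => x c; have [a [b ->]] := unco_ex x.
  by rewrite /= !aleph0E.
Defined.

Record lawvere := Lawvere {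
  lcat :> natcat;
  lemb : natfunctor aleph0 lcat;
  lemb_init : is_initial lcat 0;
  lemb_coprod : forall n m,
    is_coproduct (nmap lemb (inj1 n m)) (nmap lemb (inj2 n m)) }.

Definition kap1 (L : lawvere) n m : nhom L n (n + m) := nmap (lemb L) (inj1 n m).
Definition kap2 (L : lawvere) n m : nhom L m (n + m) := nmap (lemb L) (inj2 n m).

(* Preservation of the coprojections forces [nmap F (lemb L f) = lemb L' f]
   for all f, see [law_hom_emb]. *)
Record law_hom (L L' : lawvere) := LawHom {
  lfun :> natfunctor L L';
  lfun_kap1 : forall n m, nmap lfun (kap1 L n m) = kap1 L' n m;
  lfun_kap2 : forall n m, nmap lfun (kap2 L n m) = kap2 L' n m }.

Record smlaw := SMLawvere {
  smlaw_lawvere :> lawvere;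
  smlaw_tens : symmon smlaw_lawvere;
  smlawP : strict_symmon (lemb smlaw_lawvere) aleph0_symmon smlaw_tens }.

Record smlaw_hom (L L' : smlaw) := SMLawHom {
  smfun :> law_hom L L';
  smfunP : strict_symmon smfun (smlaw_tens L) (smlaw_tens L') }.

Lemma natfunctor_ext (C D : natcat) (F F' : natfunctor C D) :
  (forall n m (f : nhom C n m), nmap F f = nmap F' f) -> F = F'.
Proof.
case: F F' => [F F1 F2] [F' F1' F2'] /= e.
have E : F = F'.
  apply: functional_extensionality_dep => n.
  by apply: functional_extensionality_dep => m; apply: funext => f.
by subst F'; congr NatFunctor; apply: Prop_irrelevance.
Qed.

Lemma smlaw_hom_ext (L L' : smlaw) (F F' : smlaw_hom L L') :
  (forall n m (f : nhom L n m), nmap F f = nmap F' f) -> F = F'.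
Proof.
case: F F' => [[F F1 F2] F3] [[F' F1' F2'] F3'] /= /natfunctor_ext e.
subst F'; rewrite (Prop_irrelevance F1' F1) (Prop_irrelevance F2' F2) in F3' *.
by rewrite (Prop_irrelevance F3' F3).
Qed.

Definition natfunctor_id (C : natcat) : natfunctor C C :=
  @NatFunctor C C (fun _ _ f => f) (fun=> erefl) (fun _ _ _ _ _ => erefl).

Definition natfunctor_comp (C D E : natcat) (G : natfunctor D E)
    (F : natfunctor C D) : natfunctor C E.
refine (@NatFunctor C E (fun n m f => nmap G (nmap F f)) _ _).
- by move=> n; rewrite !nmap1.
- by move=> *; rewrite !nmapM.
Defined.

Definition smlaw_hom_id (L : smlaw) : smlaw_hom L L.
refine (@SMLawHom L L (@LawHom L L (natfunctor_id L) (fun _ _ => erefl)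
  (fun _ _ => erefl)) _).
by split.
Defined.

Definition law_hom_comp (L L' L'' : lawvere) (G : law_hom L' L'')
    (F : law_hom L L') : law_hom L L''.
refine (@LawHom L L'' (natfunctor_comp G F) _ _).
- by move=> n m; rewrite /= !lfun_kap1.
- by move=> n m; rewrite /= !lfun_kap2.
Defined.

Definition smlaw_hom_comp (L L' L'' : smlaw) (G : smlaw_hom L' L'')
    (F : smlaw_hom L L') : smlaw_hom L L''.
refine (@SMLawHom L L'' (law_hom_comp G F) _).
case: (smfunP G) (smfunP F) => [G1 G2 G3 G4 G5] [F1 F2 F3 F4 F5].
by split=> *; rewrite /= ?F1 ?F2 ?F3 ?F4 ?F5 ?G1 ?G2 ?G3 ?G4 ?G5.
Defined.

Definition SMLaw : category.
refine (@Category smlaw smlaw_hom smlaw_hom_id smlaw_hom_comp _ _ _).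
- by move=> L L' F; apply: smlaw_hom_ext.
- by move=> L L' F; apply: smlaw_hom_ext.
- by move=> *; apply: smlaw_hom_ext.
Defined.

(* Each [n + m] is a product of n and m for the given coproduct structure; the
   four equations force [proj1 = [id, 0]] and [proj2 = [0, id]]. *)
Record biproducts (L : lawvere) := Biproducts {
  proj1 : forall n m, nhom L (n + m) n;
  proj2 : forall n m, nhom L (n + m) m;
  bip_terminal : is_terminal L 0;
  bip_product : forall n m, is_product (proj1 n m) (proj2 n m);
  bip11 : forall n m, proj1 n m \on kap1 L n m = nid n;
  bip22 : forall n m, proj2 n m \on kap2 L n m = nid m;
  bip12 : forall n m, is_zero (proj1 n m \on kap2 L n m);
  bip21 : forall n m, is_zero (proj2 n m \on kap1 L n m) }.

Record smblaw := SMBLawvere {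
  smblaw_smlaw :> smlaw;
  smblaw_bip : biproducts smblaw_smlaw }.

Record smblaw_hom (L L' : smblaw) := SMBLawHom {
  smbfun :> smlaw_hom L L';
  smbfun_proj1 : forall n m,
    nmap smbfun (proj1 (smblaw_bip L) n m) = proj1 (smblaw_bip L') n m;
  smbfun_proj2 : forall n m,
    nmap smbfun (proj2 (smblaw_bip L) n m) = proj2 (smblaw_bip L') n m }.

Lemma smblaw_hom_ext (L L' : smblaw) (F F' : smblaw_hom L L') :
  smbfun F = smbfun F' -> F = F'.
Proof.
case: F F' => [F F1 F2] [F' F1' F2'] /= e; subst F'.
by congr SMBLawHom; apply: Prop_irrelevance.
Qed.

Definition smblaw_hom_id (L : smblaw) : smblaw_hom L L :=
  @SMBLawHom L L (smlaw_hom_id L) (fun _ _ => erefl) (fun _ _ => erefl).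

Definition smblaw_hom_comp (L L' L'' : smblaw) (G : smblaw_hom L' L'')
    (F : smblaw_hom L L') : smblaw_hom L L''.
refine (@SMBLawHom L L'' (smlaw_hom_comp G F) _ _).
- by move=> n m; rewrite /= !smbfun_proj1.
- by move=> n m; rewrite /= !smbfun_proj2.
Defined.

Definition SMBLaw : category.
refine (@Category smblaw smblaw_hom smblaw_hom_id smblaw_hom_comp _ _ _).
- by move=> L L' F; apply: smblaw_hom_ext; apply: (@compc1 SMLaw).
- by move=> L L' F; apply: smblaw_hom_ext; apply: (@comp1c SMLaw).
- by move=> *; apply: smblaw_hom_ext; apply: (@compcA SMLaw).
Defined.

Definition forget_SMBLaw : functor SMBLaw SMLaw :=
  @Functor SMBLaw SMLaw smblaw_smlaw (fun _ _ F => smbfun F) (fun=> erefl)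
    (fun _ _ _ _ _ => erefl).

Section Transport.

Variables (C : natcat) (E : natfunctor aleph0 C).
Variable T : forall n m p q, nhom C n p -> nhom C m q -> nhom C (n * m) (p * q).
Hypothesis T_emb : forall n m p q (f : nhom aleph0 n p) (g : nhom aleph0 m q),
  nmap E (tens0 f g) = T (nmap E f) (nmap E g).
Hypothesis TM : forall n m p q r s (f : nhom C n p) (f' : nhom C p r)
    (g : nhom C m q) (g' : nhom C q s),
  T (f' \on f) (g' \on g) = T f' g' \on T f g.
Hypothesis T_assoc : forall n m p n' m' p'
    (f : nhom C n n') (g : nhom C m m') (h : nhom C p p'),
  nmap E (@assoc0 n' m' p') \on T (T f g) h
  = T f (T g h) \on nmap E (@assoc0 n m p).
Hypothesis T_lunit : forall n m (f : nhom C n m),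
  nmap E (@lunit0 m) \on T (nid 1) f = f \on nmap E (@lunit0 n).
Hypothesis T_runit : forall n m (f : nhom C n m),
  nmap E (@runit0 m) \on T f (nid 1) = f \on nmap E (@runit0 n).
Hypothesis T_braid : forall n m p q (f : nhom C n p) (g : nhom C m q),
  nmap E (@braid0 p q) \on T f g = T g f \on nmap E (@braid0 n m).

Lemma nmap_iso n m (f : nhom aleph0 n m) : is_iso f -> is_iso (nmap E f).
Proof. by case=> g [gf fg]; exists (nmap E g); rewrite -!nmapM gf fg !nmap1. Qed.

Definition transport_symmon : symmon C.
refine (@SymMon C T (fun n m p => nmap E (@assoc0 n m p))
  (fun n => nmap E (@lunit0 n)) (fun n => nmap E (@runit0 n))
  (fun n m => nmap E (@braid0 n m)) _ TM _ _ _
  T_assoc T_lunit T_runit T_braid _ _ _ _).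
- by move=> n m; rewrite -!(@nmap1 _ _ E) -T_emb; congr nmap; apply: (tens1 aleph0_symmon).
- by move=> n m p; apply: nmap_iso; apply: assoc0_iso.
- by move=> n; apply: nmap_iso; apply: lunit0_iso.
- by move=> n; apply: nmap_iso; apply: runit0_iso.
- by move=> n m; rewrite -nmapM -(@nmap1 _ _ E); congr nmap; apply: (braidK aleph0_symmon).
- move=> n m p q; rewrite -!(@nmap1 _ _ E) -!T_emb -!nmapM; congr nmap.
  exact: (pentagon aleph0_symmon).
- move=> n m; rewrite -!(@nmap1 _ _ E) -!T_emb -!nmapM; congr nmap.
  exact: (triangle aleph0_symmon).
- move=> n m p; rewrite -!(@nmap1 _ _ E) -!T_emb -!nmapM; congr nmap.
  exact: (hexagon aleph0_symmon).
Defined.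

Lemma transport_strict : strict_symmon E aleph0_symmon transport_symmon.
Proof. by split. Qed.

End Transport.

Section Bind.

Variable T : monad.

Definition bind (X Y : Sets) (t : T X) (f : X -> T Y) : T Y := join (fmap f t).

Lemma bind_retl (X Y : Sets) (x : X) (f : X -> T Y) : bind (ret x) f = f x.
Proof. by rewrite /bind ret_nat join_ret. Qed.

Lemma bind_retr (X : Sets) (t : T X) : bind t ret = t.
Proof. exact: join_fmap_ret. Qed.

Lemma bindA (X Y Z : Sets) (t : T X) (f : X -> T Y) (g : Y -> T Z) :
  bind (bind t f) g = bind t (fun x => bind (f x) g).
Proof. by rewrite /bind join_nat join_join -!fmap_comp. Qed.

Lemma fmapE (X Y : Sets) (f : X -> Y) (t : T X) :
  fmap f t = bind t (fun x => ret (f x)).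
Proof. by rewrite /bind (fmap_comp ret f) join_fmap_ret. Qed.

Lemma eq_bind (X Y : Sets) (t : T X) (f g : X -> T Y) :
  (forall x, f x = g x) -> bind t f = bind t g.
Proof. by move=> /funext ->. Qed.

Lemma dstE (X Y : Sets) (s : T X) (t : T Y) :
  dst (s, t) = bind s (fun x => bind t (fun y => ret (x, y))).
Proof.
rewrite /dst /st' /st /= -fmap_comp; apply: eq_bind => x /=.
by rewrite -fmap_comp fmapE.
Qed.

Lemma dst'E (X Y : Sets) (s : T X) (t : T Y) :
  join (fmap (@st T X Y) (st' (s, t)))
  = bind t (fun y => bind s (fun x => ret (x, y))).
Proof.
rewrite /st' /st /= -!fmap_comp; apply: eq_bind => y /=.
by rewrite fmapE.
Qed.

End Bind.

Lemma bindC (T : cmonad) (X Y Z : Sets) (s : T X) (t : T Y) (f : X -> Y -> T Z) :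
  bind s (fun x => bind t (f x)) = bind t (fun y => bind s (fun x => f x y)).
Proof.
have : dst (s, t) = _ := etrans (@cmonadP T X Y (s, t)) (dst'E s t).
rewrite dstE => /(congr1 (fun u => bind u (fun p => f p.1 p.2))).
rewrite !bindA => e; apply: etrans (etrans _ e) _.
  apply: eq_bind => x; rewrite bindA; apply: eq_bind => y.
  by rewrite bind_retl.
apply: eq_bind => y; rewrite bindA; apply: eq_bind => x.
by rewrite bind_retl.
Qed.

Lemma bind_mmap (S T : monad) (s : monad_map S T) (X Y : Sets) (t : S X)
    (f : X -> S Y) : mmap s (bind t f) = bind (mmap s t) (fun x => mmap s (f x)).
Proof. by rewrite /bind mmap_join mmap_nat -fmap_comp. Qed.

Lemma dst_mmap (S T : monad) (s : monad_map S T) (X Y : Sets) (t : S X)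
    (u : S Y) : mmap s (dst (t, u)) = dst (mmap s t, mmap s u).
Proof.
rewrite !dstE bind_mmap; apply: eq_bind => x; rewrite bind_mmap.
by apply: eq_bind => y; rewrite mmap_ret.
Qed.

Section Kleisli.

Variable T : monad.

Definition Kl_natcat : natcat.
refine (@NatCat (fun n m => 'I_n -> T 'I_m) (fun n => ret)
  (fun n m p g f i => join (fmap g (f i))) _ _ _).
- by move=> n m f; apply: funext => i; apply: bind_retl.
- by move=> n m f; apply: funext => i; apply: bind_retr.
- by move=> n m p q h g f; apply: funext => i; apply: bindA.
Defined.

Definition Kl_emb : natfunctor aleph0 Kl_natcat.
refine (@NatFunctor aleph0 Kl_natcat (fun n m f i => ret (f i)) _ _).
- by [].
- by move=> n m p g f; apply: funext => i; apply: esym; apply: bind_retl.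
Defined.

Lemma Kl_initial : is_initial Kl_natcat 0.
Proof.
by move=> n; exists (fun i : 'I_0 => match notF (ltn_ord i) with end) => g;
  apply: funext => -[].
Qed.

Lemma Kl_coproduct n m :
  is_coproduct (nmap Kl_emb (inj1 n m)) (nmap Kl_emb (inj2 n m)).
Proof.
move=> p f g.
exists (fun c => match split c with inl a => f a | inr b => g b end); split.
  split; apply: funext => a; apply: etrans (bind_retl _ _) _.
    by rewrite (unsplitK (inl a)).
  by rewrite (unsplitK (inr a)).
move=> h [hf hg]; apply: funext => c; rewrite -[in RHS](splitK c).
case: (split c) => a /=.
  by rewrite -hf; apply: bind_retl.
by rewrite -hg; apply: bind_retl.
Qed.

Definition Kl_lawvere : lawvere :=
  @Lawvere Kl_natcat Kl_emb Kl_initial Kl_coproduct.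

End Kleisli.

Section KleisliTensor.

Variable T : cmonad.

Definition Kl_tens n m p q (f : nhom (Kl_natcat T) n p) (g : nhom (Kl_natcat T) m q) :
    nhom (Kl_natcat T) (n * m) (p * q) :=
  fun c => fmap (@unco p q) (dst (f (co c).1, g (co c).2)).

Lemma Kl_tensE n m p q (f : 'I_n -> T 'I_p) (g : 'I_m -> T 'I_q) a b :
  Kl_tens f g (unco (a, b))
  = bind (f a) (fun x => bind (g b) (fun y => ret (unco (x, y)))).
Proof.
rewrite /Kl_tens uncoK dstE fmapE bindA; apply: eq_bind => x.
by rewrite bindA; apply: eq_bind => y; rewrite bind_retl.
Qed.

Lemma Kl_compE n m p (g : 'I_m -> T 'I_p) (f : 'I_n -> T 'I_m) i :
  ((g : nhom (Kl_natcat T) m p) \on (f : nhom (Kl_natcat T) n m)) i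
  = bind (f i) g.
Proof. by []. Qed.

Lemma Kl_embE n m (f : nhom aleph0 n m) i : nmap (Kl_emb T) f i = ret (f i).
Proof. by []. Qed.

Definition Kl_symmon : symmon (Kl_natcat T).
refine (@transport_symmon (Kl_natcat T) (Kl_emb T) Kl_tens _ _ _ _ _ _).
- move=> n m p q f g; apply: co_ext => a b.
  by rewrite Kl_tensE !Kl_embE !bind_retl tens0E.
- move=> n m p q r s f f' g g'; apply: co_ext => a b.
  rewrite Kl_compE !Kl_tensE !Kl_compE !bindA; apply: eq_bind => x.
  rewrite bindC !bindA; apply: eq_bind => y; rewrite bind_retl Kl_tensE.
  exact: bindC.
- move=> n m p n' m' p' f g h; apply: co_ext => x c.
  have [a [b ->]] := unco_ex x; rewrite !Kl_compE Kl_embE bind_retl assoc0E.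
  rewrite !Kl_tensE !bindA; apply: eq_bind => ?; rewrite !bindA.
  apply: eq_bind => ?; rewrite bind_retl !bindA; apply: eq_bind => ?.
  by rewrite !bind_retl Kl_embE assoc0E.
- move=> n m f; apply: co_ext => a b.
  rewrite !Kl_compE Kl_embE bind_retl lunit0E Kl_tensE bind_retl bindA.
  rewrite -[RHS]bind_retr; apply: eq_bind => ?.
  by rewrite bind_retl Kl_embE lunit0E.
- move=> n m f; apply: co_ext => a b.
  rewrite !Kl_compE Kl_embE bind_retl runit0E Kl_tensE bindA.
  rewrite -[RHS]bind_retr; apply: eq_bind => ?.
  by rewrite !bind_retl Kl_embE runit0E.
- move=> n m p q f g; apply: co_ext => a b.
  rewrite !Kl_compE Kl_embE bind_retl braid0E !Kl_tensE bindC bindA.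
  apply: eq_bind => ?; rewrite !bindA; apply: eq_bind => ?.
  by rewrite !bind_retl Kl_embE braid0E.
Defined.

Definition Kl_smlaw : smlaw :=
  @SMLawvere (Kl_lawvere T) Kl_symmon (transport_strict _ _ _ _ _ _).

End KleisliTensor.

Definition Kl_natfunctor (S T : monad) (s : monad_map S T) :
  natfunctor (Kl_natcat S) (Kl_natcat T).
refine (@NatFunctor (Kl_natcat S) (Kl_natcat T) (fun n m f i => mmap s (f i)) _ _).
- by move=> n; apply: funext => i; apply: mmap_ret.
- by move=> n m p g f; apply: funext => i; apply: bind_mmap.
Defined.

Definition Kl_law_hom (S T : monad) (s : monad_map S T) :
  law_hom (Kl_lawvere S) (Kl_lawvere T).
refine (@LawHom (Kl_lawvere S) (Kl_lawvere T) (Kl_natfunctor s) _ _);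
  by move=> n m; apply: funext => i; apply: mmap_ret.
Defined.

Definition Kl_smlaw_hom (S T : cmonad) (s : monad_map S T) :
  smlaw_hom (Kl_smlaw S) (Kl_smlaw T).
refine (@SMLawHom (Kl_smlaw S) (Kl_smlaw T) (Kl_law_hom s) _).
split; try by move=> *; apply: funext => i; apply: mmap_ret.
move=> n m p q f g; apply: funext => i /=.
by rewrite /Kl_tens mmap_nat dst_mmap.
Defined.

Section KleisliBiproducts.

Variable T : acmonad.

Definition acm_zero : T void := sval (cid (acmonadP T)).

Lemma acm_zeroE (t : T void) : t = acm_zero.
Proof. exact: (svalP (cid (acmonadP T))).1. Qed.

Lemma acm_bc (X Y : Sets) : bijective (@bc T acm_zero X Y).
Proof. exact: (svalP (cid (acmonadP T))).2. Qed.

Definition Kl_proj1 n m : nhom (Kl_natcat T) (n + m) n :=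
  fun c => copr1 acm_zero (split c).
Definition Kl_proj2 n m : nhom (Kl_natcat T) (n + m) m :=
  fun c => copr2 acm_zero (split c).

Lemma Kl_terminal : is_terminal (Kl_natcat T) 0.
Proof.
move=> n; pose out (v : void) : 'I_0 := match v with end.
have into : 'I_0 -> void by case.
exists (fun=> fmap out acm_zero) => g; apply: funext => i.
rewrite -(acm_zeroE (fmap into (g i))) -fmap_comp -[LHS]fmap_id.
by congr fmap; apply: funext => -[].
Qed.

Lemma bind_zero (X : Sets) (f g : void -> T X) : bind acm_zero f = bind acm_zero g.
Proof. by apply: eq_bind. Qed.

Lemma Kl_is_zero n m (f : nhom (Kl_natcat T) n m) :
  (forall i, f i = zero_map acm_zero 'I_m i) -> is_zero f.
Proof.
move=> fE; have [b _] := Kl_initial T m.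
exists (fun=> fmap (fun v : void => match v with end) acm_zero), b.
apply: funext => i; rewrite fE Kl_compE /zero_map !fmapE bindA.
exact: bind_zero.
Qed.

Lemma Kl_product n m : is_product (@Kl_proj1 n m) (@Kl_proj2 n m).
Proof.
move=> k f g; have [bcV bcK bcVK] := acm_bc 'I_n 'I_m.
pose us (s : 'I_n + 'I_m) : 'I_(n + m) := unsplit s.
exists (fun c => fmap us (bcV (f c, g c))); split.
  have e (Z : Sets) (h : 'I_n + 'I_m -> T Z) c :
      bind (fmap us (bcV (f c, g c))) (fun x => h (split x))
      = bind (bcV (f c, g c)) h.
    by rewrite fmapE bindA; apply: eq_bind => s; rewrite bind_retl unsplitK.
  split; apply: funext => c; rewrite Kl_compE; apply: etrans (e _ _ c) _.
    by have := congr1 fst (bcVK (f c, g c)).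
  by have := congr1 snd (bcVK (f c, g c)).
move=> h [hf hg]; apply: funext => c.
have e (Z : Sets) (l : 'I_n + 'I_m -> T Z) (t : T 'I_(n + m)) :
    bind (fmap split t) l = bind t (fun x => l (split x)).
  by rewrite fmapE bindA; apply: eq_bind => s; rewrite bind_retl.
rewrite (_ : (f c, g c) = bc acm_zero (fmap split (h c))).
  rewrite bcK -fmap_comp -[RHS]fmap_id; congr fmap; apply: funext => i.
  exact: splitK.
by rewrite /bc -hf -hg; congr pair; apply/esym/e.
Qed.

Definition Kl_biproducts : biproducts (Kl_lawvere T).
refine (@Biproducts (Kl_lawvere T) Kl_proj1 Kl_proj2 Kl_terminal Kl_product
  _ _ _ _).
- move=> n m; apply: funext => a; apply: etrans (bind_retl _ _) _.
  by rewrite /Kl_proj1 (unsplitK (inl a)).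
- move=> n m; apply: funext => a; apply: etrans (bind_retl _ _) _.
  by rewrite /Kl_proj2 (unsplitK (inr a)).
- move=> n m; apply: Kl_is_zero => a; apply: etrans (bind_retl _ _) _.
  by rewrite /Kl_proj1 (unsplitK (inr a)).
- move=> n m; apply: Kl_is_zero => a; apply: etrans (bind_retl _ _) _.
  by rewrite /Kl_proj2 (unsplitK (inl a)).
Defined.

Definition Kl_smblaw : smblaw := @SMBLawvere (Kl_smlaw T) Kl_biproducts.

End KleisliBiproducts.

Lemma zero_map_mmap (S T : acmonad) (s : monad_map S T) (X Y : Sets) (x : X) :
  mmap s (zero_map (acm_zero S) Y x) = zero_map (acm_zero T) Y x.
Proof. by rewrite /zero_map mmap_nat -(acm_zeroE (mmap s (acm_zero S))). Qed.

Definition Kl_smblaw_hom (S T : acmonad) (s : monad_map S T) :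
  smblaw_hom (Kl_smblaw S) (Kl_smblaw T).
refine (@SMBLawHom (Kl_smblaw S) (Kl_smblaw T) (Kl_smlaw_hom s) _ _);
  move=> n m; apply: funext => c; rewrite /= /Kl_proj1 /Kl_proj2;
  by case: (split c) => a /=; rewrite ?mmap_ret ?zero_map_mmap.
Defined.

Definition KlN : functor ACMnd SMBLaw.
refine (@Functor ACMnd SMBLaw Kl_smblaw Kl_smblaw_hom _ _).
- by move=> T; apply: smblaw_hom_ext; apply: smlaw_hom_ext.
- by move=> S T U s' s; apply: smblaw_hom_ext; apply: smlaw_hom_ext.
Defined.

Section LawvereTheory.

Variable L : lawvere.

Lemma lcoprod_ext n m p (H H' : nhom L (n + m) p) :
  H \on kap1 L n m = H' \on kap1 L n m -> H \on kap2 L n m = H' \on kap2 L n m ->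
  H = H'.
Proof.
move=> e1 e2.
have [h [_ hU]] := lemb_coprod (H' \on kap1 L n m) (H' \on kap2 L n m).
by rewrite -(hU H) // -(hU H').
Qed.

(* The [a]-th coprojection of [n = 1 + ... + 1]. *)
Definition pt n (a : 'I_n) : nhom aleph0 1 n := fun=> a.

Lemma pt_comp n m (f : nhom aleph0 n m) a : f \on pt a = pt (f a).
Proof. by []. Qed.

Lemma pt1 (a : 'I_1) : pt a = nid 1.
Proof. by apply: funext => b; rewrite (ord1 a) (ord1 b). Qed.

Lemma pt_inj1 n (a : 'I_1) : pt (lshift n a) = inj1 1 n \on pt a.
Proof. by []. Qed.

Lemma hom_ext n m (H H' : nhom L n m) :
  (forall a, H \on nmap (lemb L) (pt a) = H' \on nmap (lemb L) (pt a)) -> H = H'.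
Proof.
elim: n H H' => [|n IH] H H' e.
  by have [z zU] := @lemb_init L m; rewrite (zU H) (zU H').
apply: (@lcoprod_ext 1 n).
  have := e (@lshift 1 n ord0).
  by rewrite pt_inj1 pt1 nmapM nmap1 ncomp1.
apply: IH => a; rewrite -!ncompA -nmapM.
exact: (e (@rshift 1 n a)).
Qed.

Lemma cotuple_subproof n m (h : 'I_n -> nhom L 1 m) :
  exists H : nhom L n m, forall a, H \on nmap (lemb L) (pt a) = h a.
Proof.
elim: n h => [|n IH] h.
  by have [z _] := @lemb_init L m; exists z => -[].
have [H HE] := IH (fun a => h (@rshift 1 n a)).
have [K [[K1 K2] _]] := @lemb_coprod L 1 n _ (h (@lshift 1 n ord0)) H.
exists K => a; rewrite -(@splitK 1 n a); case: (@split 1 n a) => {}a /=.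
  by rewrite pt_inj1 nmapM ncompA K1 pt1 nmap1 ncomp1 (ord1 a).
by rewrite -HE -K2 -ncompA -nmapM.
Qed.

(* The cotuple [h_0, ..., h_(n-1)] : n -> m. *)
Definition cotuple n m (h : 'I_n -> nhom L 1 m) : nhom L n m :=
  sval (cid (cotuple_subproof h)).

Lemma cotupleE n m (h : 'I_n -> nhom L 1 m) a :
  cotuple h \on nmap (lemb L) (pt a) = h a.
Proof. exact: (svalP (cid (cotuple_subproof h))). Qed.

Lemma cotuple_uniq n m (h : 'I_n -> nhom L 1 m) H :
  (forall a, H \on nmap (lemb L) (pt a) = h a) -> cotuple h = H.
Proof. by move=> HE; apply: hom_ext => a; rewrite cotupleE HE. Qed.

Lemma cotuple_emb n m p (h : 'I_m -> nhom L 1 p) (f : nhom aleph0 n m) :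
  cotuple h \on nmap (lemb L) f = cotuple (fun a => h (f a)).
Proof.
by apply: hom_ext => a; rewrite -ncompA -nmapM pt_comp !cotupleE.
Qed.

(* The sum g_0 + ... + g_(n-1) : n -> j_0 + ... + j_(n-1) of g_a : 1 -> j_a;
   [tagnat.Rank a : 'I_(j a) -> 'I_(\sum_a j a)] is the a-th coprojection. *)
Definition lsum n (j : 'I_n -> nat) (g : forall a, nhom L 1 (j a)) :
    nhom L n (\sum_(a < n) j a) :=
  cotuple (fun a => nmap (lemb L) (@tagnat.Rank n j a : nhom aleph0 _ _) \on g a).

Record term (X : Sets) : Sets := Term {
  arity : nat;
  op : nhom L 1 arity;
  args : 'I_arity -> X }.

Arguments args {X} t a : rename.

Inductive term_step (X : Sets) : term X -> term X -> Prop :=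
  TermStep i m (f : nhom aleph0 i m) (g : nhom L 1 i) (v : 'I_m -> X) :
    term_step (@Term X m (nmap (lemb L) f \on g) v) (@Term X i g (v \o f)).

(* [TL_obj X] is the set of equivalence classes of the least equivalence
   relation containing [term_step]. *)
Definition teq (X : Sets) : term X -> term X -> Prop :=
  clos_refl_sym_trans (term X) (@term_step X).

Definition TL_obj (X : Sets) : Sets :=
  {P : term X -> Prop | exists r, P = teq r}.

Definition cls (X : Sets) (r : term X) : TL_obj X :=
  exist _ (teq r) (ex_intro _ r erefl).

Definition repr (X : Sets) (q : TL_obj X) : term X := sval (cid (svalP q)).

Lemma reprK (X : Sets) : cancel (@repr X) (@cls X).
Proof.
move=> q; have := svalP (cid (svalP q)); rewrite -/(repr q).
by case: q => P ?  /= e; apply: eq_exist; rewrite -e.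
Qed.

Lemma teq_refl (X : Sets) (r : term X) : teq r r. Proof. exact: rst_refl. Qed.
Lemma teq_sym (X : Sets) (r s : term X) : teq r s -> teq s r.
Proof. exact: rst_sym. Qed.
Lemma teq_trans (X : Sets) (s r t : term X) : teq r s -> teq s t -> teq r t.
Proof. exact: rst_trans. Qed.

Lemma clsP (X : Sets) (r s : term X) : cls r = cls s <-> teq r s.
Proof.
split=> [[e]|e]; first by rewrite e; apply: teq_refl.
apply: eq_exist; apply: funext => t; apply: propext; split=> h.
  exact: teq_trans (teq_sym e) h.
exact: teq_trans e h.
Qed.

Lemma cls_emb (X : Sets) i m (f : nhom aleph0 i m) (g : nhom L 1 i) (v : 'I_m -> X) w :
  (forall a, v (f a) = w a) -> cls (Term (nmap (lemb L) f \on g) v) = cls (Term g w).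
Proof. by move=> /funext <-; apply/clsP; apply: rst_step; apply: TermStep. Qed.

Lemma clsE (X : Sets) i (g g' : nhom L 1 i) (v v' : 'I_i -> X) :
  g = g' -> (forall a, v a = v' a) -> cls (Term g v) = cls (Term g' v').
Proof. by move=> -> /funext ->. Qed.

Lemma TL_ind (X : Sets) (P : TL_obj X -> Prop) :
  (forall i (g : nhom L 1 i) v, P (cls (Term g v))) -> forall q, P q.
Proof. by move=> IH q; rewrite -(reprK q); case: (repr q). Qed.

Lemma teq_ind (X Y : Sets) (F : term X -> term Y) :
  (forall r s, term_step r s -> teq (F r) (F s)) ->
  forall r s, teq r s -> teq (F r) (F s).
Proof.
move=> FS r s; elim=> [{}r {}s /FS //| {}r | {}r {}s _ | {}r {}s t _ h _ h'].
- exact: teq_refl.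
- exact: teq_sym.
- exact: teq_trans h h'.
Qed.

Definition term_map (X Y : Sets) (h : X -> Y) (r : term X) : term Y :=
  Term (op r) (h \o args r).

Definition TL_fmap (X Y : Sets) (h : X -> Y) (q : TL_obj X) : TL_obj Y :=
  cls (term_map h (repr q)).

Lemma TL_fmapE (X Y : Sets) (h : X -> Y) i (g : nhom L 1 i) v :
  TL_fmap h (cls (Term g v)) = cls (Term g (h \o v)).
Proof.
apply/clsP; apply: (@teq_ind _ _ (term_map h)) (Term g v) _; last first.
  by apply/clsP; rewrite reprK.
by move=> _ _ [j m f k w]; apply: rst_step; apply: (@TermStep _ _ _ f k (h \o w)).
Qed.

Definition TL_ret (X : Sets) (x : X) : TL_obj X := cls (@Term X 1 (nid 1) (fun=> x)).

Definition term_sum (X : Sets) i (g : nhom L 1 i) (w : 'I_i -> term X) : term X :=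
  @Term X (\sum_(a < i) arity (w a)) (lsum (fun a => op (w a)) \on g)
    (fun c => args (w (tag (tagnat.sig c))) (tagged (tagnat.sig c))).

(* Independent of the chosen representatives, see [TL_joinE]. *)
Definition TL_join (X : Sets) (q : TL_obj (TL_obj X)) : TL_obj X :=
  cls (term_sum (op (repr q)) (fun a => repr (args (repr q) a))).

Definition dstep (X : Sets) (r s : term X) : Prop :=
  exists f : nhom aleph0 (arity r) (arity s),
    op s = nmap (lemb L) f \on op r /\ args r = args s \o f.

Lemma dstep_cls (X : Sets) (r s : term X) : dstep r s -> cls r = cls s.
Proof.
case: r s => i g v [m g' v'] [f /= [-> ->]]; apply/esym.
exact: cls_emb.
Qed.

Lemma dstep_refl (X : Sets) (r : term X) : dstep r r.
Proof. by exists (nid _); rewrite nmap1 n1comp. Qed.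

Lemma dstep_trans (X : Sets) (r s t : term X) : dstep r s -> dstep s t -> dstep r t.
Proof.
move=> [f [f1 f2]] [f' [f1' f2']]; exists (f' \on f).
by rewrite f1' f1 f2 f2' nmapM ncompA.
Qed.

Lemma finite_images (X : Sets) n1 n2 (v1 : 'I_n1 -> X) (v2 : 'I_n2 -> X) :
  exists m (s : 'I_m -> X) (h1 : 'I_n1 -> 'I_m) (h2 : 'I_n2 -> 'I_m),
    [/\ injective s, v1 = s \o h1 & v2 = s \o h2].
Proof.
pose l : seq {classic X} := undup (codom (v1 : _ -> {classic X}) ++ codom (v2 : _ -> {classic X})).
have l1 a : (v1 a : {classic X}) \in l by rewrite mem_undup mem_cat codom_f.
have l2 a : (v2 a : {classic X}) \in l by rewrite mem_undup mem_cat codom_f orbT.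
pose ix (x : {classic X}) (xl : x \in l) : 'I_(size l) :=
  Ordinal (etrans (index_mem x l) xl).
have ixE x xl : tnth (in_tuple l) (@ix x xl) = x.
  by rewrite (tnth_nth x) /= nth_index.
exists (size l), (tnth (in_tuple l)), (fun a => ix _ (l1 a)), (fun a => ix _ (l2 a)).
split; [|by apply: funext => a; rewrite /= ixE..].
move=> a b; have [x0 _] : exists x0 : {classic X}, True by exists (tnth (in_tuple l) a).
rewrite !(tnth_nth x0) /= => e; apply/val_inj/eqP.
by rewrite -(nth_uniq x0 (ltn_ord a) (ltn_ord b) (undup_uniq _)); apply/eqP.
Qed.

Lemma dstep_diamond (X : Sets) (r s t : term X) :
  dstep r s -> dstep r t -> exists u, dstep s u /\ dstep t u.
Proof.
case: r s t => i g v [j g1 v1] [k g2 v2] [f1 /= [-> e1]] [f2 /= [-> e2]].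
have [m [w [h1 [h2 [wI w1 w2]]]]] := finite_images v1 v2.
have e : (h1 : nhom aleph0 j m) \on f1 = (h2 : nhom aleph0 k m) \on f2.
  apply: funext => a; apply: wI.
  have := congr1 (fun u => u a) e1; have := congr1 (fun u => u a) e2.
  by rewrite w1 w2 /= => -> /esym.
exists (Term (nmap (lemb L) (h1 : nhom aleph0 j m) \on (nmap (lemb L) f1 \on g)) w).
split; first by exists h1.
by exists h2; rewrite /= !ncompA -!nmapM e.
Qed.

Lemma teq_join (X : Sets) (r s : term X) :
  teq r s -> exists u, dstep r u /\ dstep s u.
Proof.
elim=> {r s} [_ _ [i m f g v]|r|r s _ [u [? ?]]|r s t _ [u [ru su]] _ [u' [su' tu']]].
- exists (Term (nmap (lemb L) f \on g) v); split; first exact: dstep_refl.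
  by exists f.
- by exists r; split; apply: dstep_refl.
- by exists u.
- have [w [uw uw']] := dstep_diamond su su'.
  by exists w; split; [apply: dstep_trans ru uw | apply: dstep_trans tu' uw'].
Qed.

Lemma term_sum_dstep (X : Sets) i (g : nhom L 1 i) (w w' : 'I_i -> term X) :
  (forall a, dstep (w a) (w' a)) -> dstep (term_sum g w) (term_sum g w').
Proof.
move=> ww'; pose f a := sval (cid (ww' a)).
have fE a : op (w' a) = nmap (lemb L) (f a) \on op (w a) /\
    args (w a) = args (w' a) \o f a by apply: (svalP (cid (ww' a))).
pose F : nhom aleph0 (\sum_(a < i) arity (w a)) (\sum_(a < i) arity (w' a)) :=
  
  fun c => @tagnat.Rank i (fun a => arity (w' a)) _ (f _ (tagged (tagnat.sig c))).
exists F; split; last first.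
  apply: funext => c; rewrite /F /= /tagnat.Rank tagnat.rankK /=.
  exact: (congr1 (fun u => u _) (fE _).2).
rewrite /= ncompA; congr (_ \on g).
apply: hom_ext => a; rewrite -ncompA !cotupleE (fE a).1 !ncompA -!nmapM.
congr (nmap _ _ \on _); apply: funext => b.
by rewrite /F /= /tagnat.Rank tagnat.rankK.
Qed.

Lemma term_sum_teq (X : Sets) i (g : nhom L 1 i) (w w' : 'I_i -> term X) :
  (forall a, teq (w a) (w' a)) -> teq (term_sum g w) (term_sum g w').
Proof.
move=> /(fun h a => cid (teq_join (h a))) h; apply/clsP.
pose u a := sval (h a).
transitivity (cls (term_sum g u)); last apply/esym;
  by apply: dstep_cls; apply: term_sum_dstep => a; case: (svalP (h a)).
Qed.

Lemma term_sum_common (X : Sets) i (g : nhom L 1 i) m (h : 'I_i -> nhom L 1 m)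
    (s : 'I_m -> X) :
  teq (term_sum g (fun a => Term (h a) s)) (Term (cotuple h \on g) s).
Proof.
apply/clsP; apply: dstep_cls.
exists (fun c => tagged (tagnat.sig c)); split=> //=.
rewrite ncompA; congr (_ \on g); apply: hom_ext => a.
rewrite -ncompA !cotupleE ncompA -nmapM -[LHS]n1comp -(nmap1 (lemb L)).
congr (nmap _ _ \on _); apply: funext => b.
by rewrite /= /tagnat.Rank tagnat.rankK.
Qed.

Lemma TL_common (X : Sets) i (q : 'I_i -> TL_obj X) :
  exists m (h : 'I_i -> nhom L 1 m) (s : 'I_m -> X), forall a, q a = cls (Term (h a) s).
Proof.
pose w a := repr (q a).
exists (\sum_(a < i) arity (w a)),
  (fun a => nmap (lemb L) (@tagnat.Rank i (fun a => arity (w a)) a : nhom aleph0 _ _)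
            \on op (w a)),
  (fun c => args (w (tag (tagnat.sig c))) (tagged (tagnat.sig c))).
move=> a; rewrite -(reprK (q a)); apply: dstep_cls.
exists (@tagnat.Rank i (fun a => arity (w a)) a); split=> //=.
by apply: funext => b; rewrite /= /tagnat.Rank tagnat.rankK.
Qed.

Lemma term_join_common (X : Sets) i (g : nhom L 1 i) (q : 'I_i -> TL_obj X)
    m (h : 'I_i -> nhom L 1 m) (s : 'I_m -> X) :
  (forall a, q a = cls (Term (h a) s)) ->
  teq (term_sum g (fun a => repr (q a))) (Term (cotuple h \on g) s).
Proof.
move=> e; apply: teq_trans (term_sum_common _ _ _); apply: term_sum_teq => a.
by apply/clsP; rewrite reprK e.
Qed.

Lemma TL_join_repr (X : Sets) i (g : nhom L 1 i) (q : 'I_i -> TL_obj X) :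
  TL_join (cls (Term g q)) = cls (term_sum g (fun a => repr (q a))).
Proof.
pose F (r : term (TL_obj X)) := term_sum (op r) (fun a => repr (args r a)).
apply/clsP; apply: (@teq_ind _ _ F) (Term g q) _; last first.
  by apply/clsP; rewrite reprK.
move=> _ _ [j m f k v]; rewrite /F /=.
have [p [h [s hs]]] := TL_common v.
apply: teq_trans (term_join_common _ hs) _; rewrite ncompA cotuple_emb.
by apply: teq_sym; apply: term_join_common => a; rewrite /= hs.
Qed.

Lemma TL_joinE (X : Sets) i (g : nhom L 1 i) (w : 'I_i -> term X) :
  TL_join (cls (Term g (fun a => cls (w a)))) = cls (term_sum g w).
Proof.
rewrite TL_join_repr; apply/clsP; apply: term_sum_teq => a.
by apply/clsP; rewrite reprK.
Qed.

Lemma TL_join_common (X : Sets) i (g : nhom L 1 i) (q : 'I_i -> TL_obj X)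
    m (h : 'I_i -> nhom L 1 m) (s : 'I_m -> X) :
  (forall a, q a = cls (Term (h a) s)) ->
  TL_join (cls (Term g q)) = cls (Term (cotuple h \on g) s).
Proof. by move=> e; rewrite TL_join_repr; apply/clsP; apply: term_join_common. Qed.

Definition TL : monad.
refine (@Monad TL_obj TL_fmap TL_ret TL_join _ _ _ _ _ _ _).
- by move=> X; apply: TL_ind => i g v; rewrite TL_fmapE.
- by move=> X Y Z g f; apply: TL_ind => i k v; rewrite !TL_fmapE.
- by move=> X Y f x; rewrite /TL_ret TL_fmapE.
- move=> X Y f; apply: TL_ind => i g q; have [m [h [s hs]]] := TL_common q.
  rewrite (TL_join_common _ hs) !TL_fmapE.
  by apply/esym; apply: TL_join_common => a; rewrite /= hs TL_fmapE.
- move=> X; apply: TL_ind => i g q; have [m [h [s hs]]] := TL_common q.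
  have [p [k [t kt]]] := TL_common s.
  rewrite (TL_join_common _ hs) (TL_join_common _ kt) TL_fmapE.
  rewrite (@TL_join_common _ _ _ _ _ (fun a => cotuple k \on h a) t).
    rewrite ncompA; congr (cls (Term (_ \on g) _)).
    by apply: hom_ext => a; rewrite -ncompA !cotupleE.
  by move=> a; rewrite /= hs (TL_join_common _ kt).
- move=> X; apply: TL_ind => i g v.
  rewrite /TL_ret (@TL_join_common _ _ _ _ _ (fun=> g) v) //.
  rewrite ncomp1; congr (cls (Term _ _)).
  by apply: cotuple_uniq => a; rewrite pt1 nmap1 ncomp1.
- move=> X; apply: TL_ind => i g v; rewrite TL_fmapE.
  rewrite (@TL_join_common _ _ _ _ _ (fun a => nmap (lemb L) (pt a)) v).
    rewrite (@cotuple_uniq _ _ _ (nid i)) ?n1comp // => a.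
    by rewrite n1comp.
  by move=> a; rewrite /= -[nmap _ _]ncomp1 (@cls_emb _ _ _ _ _ _ (fun=> v a)).
Defined.

End LawvereTheory.

Arguments args {L X} t a : rename.

Section LawvereMorphism.

Variables (L L' : lawvere) (F : law_hom L L').

Lemma law_hom_emb n m (f : nhom aleph0 n m) : nmap F (nmap (lemb L) f) = nmap (lemb L') f.
Proof.
have pE k (a : 'I_k) : nmap F (nmap (lemb L) (pt a)) = nmap (lemb L') (pt a).
  elim: k a => [[]//|k IH] a; rewrite -(@splitK 1 k a).
  case: (@split 1 k a) => {}a.
    by rewrite [unsplit _]/= pt_inj1 pt1 ncomp1; apply: (lfun_kap1 F 1 k).
  have e : pt (unsplit (inr a) : 'I_(1 + k)) = inj2 1 k \on pt a by [].
  by rewrite e !nmapM IH (@nmapM _ _ (lemb L') _ _ _ (inj2 1 k)); congr (_ \on _); apply: (lfun_kap2 F 1 k).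
elim: n f => [|n IH] f.
  have [z zU] := @lemb_init L' m.
  by rewrite (zU (nmap F _)) (zU (nmap _ f)).
apply: (@lcoprod_ext L' 1 n).
  have e : f \on inj1 1 n = pt (f (@lshift 1 n ord0)).
    by apply: funext => a; rewrite /= (ord1 a).
  rewrite -{1}(lfun_kap1 F) -!nmapM e; exact: pE.
by rewrite -{1}(lfun_kap2 F) -!nmapM; apply: IH.
Qed.

Lemma law_hom_cotuple n m (h : 'I_n -> nhom L 1 m) :
  nmap F (cotuple h) = cotuple (fun a => nmap F (h a)).
Proof.
apply/esym; apply: cotuple_uniq => a.
by rewrite -law_hom_emb -nmapM cotupleE.
Qed.

Definition term_mmap (X : Sets) (r : term L X) : term L' X :=
  Term (nmap F (op r)) (args r).

Definition TL_mmap (X : Sets) (q : TL_obj L X) : TL_obj L' X :=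
  cls (term_mmap (repr q)).

Lemma TL_mmapE (X : Sets) i (g : nhom L 1 i) (v : 'I_i -> X) :
  TL_mmap (cls (Term g v)) = cls (Term (nmap F g) v).
Proof.
apply/clsP.
have h : forall r s : term L X, teq r s -> teq (term_mmap r) (term_mmap s).
  move=> r s; elim=> {r s} [_ _ [j m f k w]|r|r s _|r s t _ h _ h'].
  - rewrite /term_mmap /= nmapM law_hom_emb; apply: rst_step; exact: TermStep.
  - exact: teq_refl.
  - exact: teq_sym.
  - exact: teq_trans h h'.
by apply: (h _ (Term g v)); apply/clsP; rewrite reprK.
Qed.

Definition TL_map : monad_map (TL L) (TL L').
refine (@MonadMap (TL L) (TL L') TL_mmap _ _ _).
- move=> X Y f; apply: TL_ind => i g v.
  by rewrite /fmap /= TL_fmapE !TL_mmapE TL_fmapE.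
- by move=> X x; rewrite /ret /= /TL_ret TL_mmapE nmap1.
- move=> X; apply: TL_ind => i g q; have [m [h [s hs]]] := TL_common q.
  rewrite /fmap /join /= (TL_join_common _ hs) !TL_mmapE TL_fmapE nmapM.
  rewrite law_hom_cotuple; apply/esym; apply: TL_join_common => a.
  by rewrite /= hs TL_mmapE.
Defined.

End LawvereMorphism.

Section Commutativity.

Variable L : smlaw.
Let E n m (f : nhom aleph0 n m) : nhom L n m := nmap (lemb L) f.
Let tn := @tens L (smlaw_tens L).
Let lunV n : nhom aleph0 n (1 * n) := fun b => unco (ord0, b).
Let runV n : nhom aleph0 n (n * 1) := fun a => unco (a, ord0).

Lemma lunV_nat n m (h : nhom L n m) : tn (nid 1) h \on E (@lunV n) = E (@lunV m) \on h.
Proof.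
have e k : @lunit0 k \on @lunV k = nid k.
  by apply: funext => b; rewrite /= lunit0E.
have e' k : @lunV k \on @lunit0 k = nid (1 * k).
  by apply: co_ext => a b; rewrite /= lunit0E /lunV (ord1 a).
have := lunit_nat (smlaw_tens L) h; rewrite -!(strict_lunit (smlawP L)).
move=> /(congr1 (fun u => E (@lunV m) \on u \on E (@lunV n))).
rewrite !ncompA -nmapM e' nmap1 n1comp => ->.
by rewrite -!ncompA -nmapM e nmap1 ncomp1.
Qed.

Lemma runV_nat n m (h : nhom L n m) : tn h (nid 1) \on E (@runV n) = E (@runV m) \on h.
Proof.
have e k : @runit0 k \on @runV k = nid k.
  by apply: funext => b; rewrite /= runit0E.
have e' k : @runV k \on @runit0 k = nid (k * 1).
  by apply: co_ext => a b; rewrite /= runit0E /runV (ord1 b).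
have := runit_nat (smlaw_tens L) h; rewrite -!(strict_runit (smlawP L)).
move=> /(congr1 (fun u => E (@runV m) \on u \on E (@runV n))).
rewrite !ncompA -nmapM e' nmap1 n1comp => ->.
by rewrite -!ncompA -nmapM e nmap1 ncomp1.
Qed.

Lemma tn_emb n m p q (f : nhom aleph0 n p) (g : nhom aleph0 m q) :
  tn (E f) (E g) = E (tens0 f g).
Proof. exact/esym/(strict_tens (smlawP L)). Qed.

Lemma tnC n m p q (f : nhom L n p) (g : nhom L m q) :
  tn f (nid q) \on tn (nid n) g = tn (nid p) g \on tn f (nid m).
Proof. by rewrite /tn -!tensM !ncomp1 !n1comp. Qed.

Lemma cotuple_r i j (g : nhom L 1 i) (h : nhom L 1 j) :
  cotuple (fun a : 'I_i => E (fun b => unco (a, b)) \on h) \on g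
  = tn (nid i) h \on tn g (nid 1) \on E (@lunV 1).
Proof.
have -> : @lunV 1 = @runV 1 by apply: funext => a; rewrite /lunV /runV (ord1 a).
rewrite -ncompA runV_nat ncompA; congr (_ \on g); apply: cotuple_uniq => a.
rewrite -ncompA -runV_nat ncompA -tnC -ncompA.
have -> : @runV 1 = @lunV 1 by apply: funext => b; rewrite /lunV /runV (ord1 b).
rewrite lunV_nat ncompA -(nmap1 (lemb L)) tn_emb -nmapM; congr (E _ \on _).
by apply: funext => b; rewrite /= tens0E.
Qed.

Lemma cotuple_l i j (g : nhom L 1 i) (h : nhom L 1 j) :
  cotuple (fun b : 'I_j => E (fun a => unco (a, b)) \on g) \on h
  = tn (nid i) h \on tn g (nid 1) \on E (@lunV 1).
Proof.
rewrite -tnC -ncompA lunV_nat ncompA; congr (_ \on h); apply: cotuple_uniq => b.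
rewrite -ncompA -lunV_nat ncompA tnC -ncompA.
have -> : @lunV 1 = @runV 1 by apply: funext => a; rewrite /lunV /runV (ord1 a).
rewrite runV_nat ncompA -(nmap1 (lemb L)) tn_emb -nmapM; congr (E _ \on _).
by apply: funext => a; rewrite /= tens0E.
Qed.

Lemma TL_commutative : commutative_monad (TL L).
Proof.
move=> X Y [u t]; move: u t; apply: TL_ind => i g v; apply: TL_ind => j h w.
pose s c := (v (co c).1, w (co c).2).
rewrite /st' /st /fmap /join /= !TL_fmapE.
rewrite (@TL_join_common _ _ _ _ _ _
  (fun a : 'I_i => E (fun b : 'I_j => unco (a, b)) \on h) s); last first.
  move=> a; rewrite /= !TL_fmapE; apply/esym; apply: cls_emb => b.
  by rewrite /s uncoK.
rewrite (@TL_join_common _ _ _ _ _ _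
  (fun b : 'I_j => E (fun a : 'I_i => unco (a, b)) \on g) s); last first.
  move=> b; rewrite /= !TL_fmapE; apply/esym; apply: cls_emb => a.
  by rewrite /s uncoK.
by rewrite cotuple_r cotuple_l.
Qed.

End Commutativity.

Definition TL_cmonad (L : smlaw) : cmonad := CMonad (@TL_commutative L).

Definition calT : functor SMLaw CMnd.
refine (@Functor SMLaw CMnd TL_cmonad (fun L L' F => TL_map F) _ _).
- move=> L; apply: monad_map_ext => X; apply: TL_ind => i g v.
  exact: TL_mmapE.
- move=> L L' L'' G F; apply: monad_map_ext => X; apply: TL_ind => i g v.
  by rewrite /= !TL_mmapE.
Defined.

(* Main.v *)
(* The unit L -> Kl(T_L) sends H : n -> m to i |-> [H o pt i, id], and the
   transpose of G : L -> Kl(B) sends [g, v] to B(v)(G(g)(0)); since [g, v] is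
   T_L(v) applied to the value of the unit at g, a monad map out of T_L is
   determined by its composite with the unit. The biproducts add only
   properties: projections are determined by the coproduct and zero maps, so
   every law_hom preserves them. Additivity of T_L holds because an element of
   T_L(X + Y) can be written [g, [v, w]] with g : 1 -> n + m, v : n -> X and
   w : m -> Y, and bc maps it to ([pi_1 o g, v], [pi_2 o g, w]). *)
Require Import Defs.
From mathcomp Require Import all_boot boolp.

Set Implicit Arguments.
Unset Strict Implicit.
Unset Printing Implicit Defensive.

(** [bijective] asks for an inverse function; choice through [cid] supplies one. *)
Lemma inj_surj_bijective (A B : Type) (f : A -> B) :
  injective f -> (forall b, exists a, f a = b) -> bijective f.
Proof.
move=> fI fS; have fK b : f (sval (cid (fS b))) = b by exact: svalP (cid (fS b)).
by exists (fun b => sval (cid (fS b))) => // a; apply: fI.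
Qed.

(** * Zero morphisms and preservation of biproduct projections *)

Section Biproducts.

Variable L : lawvere.

Definition zero_mor (t0 : is_terminal L 0) n m : nhom L n m :=
  sval (cid (lemb_init L m)) \on sval (cid (t0 n)).

Lemma zero_morE (t0 : is_terminal L 0) n m (f : nhom L n m) :
  is_zero f -> f = zero_mor t0 n m.
Proof.
move=> [a [b ->]]; rewrite /zero_mor.
by rewrite (svalP (cid (t0 n)) a) (svalP (cid (lemb_init L m)) b).
Qed.

Lemma is_zero_unique (t0 : is_terminal L 0) n m (f g : nhom L n m) :
  is_zero f -> is_zero g -> f = g.
Proof. by move=> /(zero_morE t0) -> /(zero_morE t0). Qed.

Lemma is_zero_compl n m p (g : nhom L m p) (f : nhom L n m) :
  is_zero f -> is_zero (g \on f).
Proof. by move=> [a [b ->]]; exists a, (g \on b); rewrite ncompA. Qed.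

Lemma is_zero_compr n m p (g : nhom L m p) (f : nhom L n m) :
  is_zero g -> is_zero (g \on f).
Proof. by move=> [a [b ->]]; exists (a \on f), b; rewrite ncompA. Qed.

End Biproducts.

(** Being zero means factoring through the object 0, which a morphism of theories fixes. *)
Lemma law_hom_is_zero (L L' : lawvere) (F : law_hom L L') n m (f : nhom L n m) :
  is_zero f -> is_zero (nmap F f).
Proof. by move=> [a [b ->]]; exists (nmap F a), (nmap F b); rewrite nmapM. Qed.

Lemma law_hom_proj1 (L L' : lawvere) (b : biproducts L) (b' : biproducts L')
  (F : law_hom L L') n m : nmap F (proj1 b n m) = proj1 b' n m.
Proof.
apply: lcoprod_ext; first by rewrite -(lfun_kap1 F) -nmapM !bip11 nmap1 lfun_kap1 bip11.
rewrite -{1}(lfun_kap2 F) -nmapM; apply: (is_zero_unique (bip_terminal b')).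
  by apply: law_hom_is_zero; apply: bip12.
exact: bip12.
Qed.

Lemma law_hom_proj2 (L L' : lawvere) (b : biproducts L) (b' : biproducts L')
  (F : law_hom L L') n m : nmap F (proj2 b n m) = proj2 b' n m.
Proof.
apply: lcoprod_ext; last by rewrite -(lfun_kap2 F) -nmapM !bip22 nmap1 lfun_kap2 bip22.
rewrite -{1}(lfun_kap1 F) -nmapM; apply: (is_zero_unique (bip_terminal b')).
  by apply: law_hom_is_zero; apply: bip21.
exact: bip21.
Qed.

(** * Functions out of ['I_(n + m)] and separation of variables in [X + Y] *)

Definition sum_fun n m (Z : Type) (f : 'I_n -> Z) (g : 'I_m -> Z) (c : 'I_(n + m)) : Z :=
  match split c with inl a => f a | inr b => g b end.

Lemma sum_fun_l n m (Z : Type) (f : 'I_n -> Z) (g : 'I_m -> Z) a :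
  sum_fun f g (lshift m a) = f a.
Proof. by rewrite /sum_fun (unsplitK (inl a)). Qed.

Lemma sum_fun_r n m (Z : Type) (f : 'I_n -> Z) (g : 'I_m -> Z) b :
  sum_fun f g (rshift n b) = g b.
Proof. by rewrite /sum_fun (unsplitK (inr b)). Qed.

(** This is the sum [v + w] of two functions, read along [split]; the cotuple is [sum_fun]. *)
Definition copair n m (X Y : Type) (v : 'I_n -> X) (w : 'I_m -> Y) :
    'I_(n + m) -> X + Y :=
  sum_fun (inl \o v) (inr \o w).

Definition sum_map n m p q (f : 'I_n -> 'I_p) (g : 'I_m -> 'I_q) :
    'I_(n + m) -> 'I_(p + q) :=
  sum_fun (@lshift p q \o f) (@rshift p q \o g).

Lemma split_eq n m (Z : Type) (f g : 'I_(n + m) -> Z) :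
  (forall a, f (lshift m a) = g (lshift m a)) ->
  (forall b, f (rshift n b) = g (rshift n b)) -> forall c, f c = g c.
Proof. by move=> fl fr c; rewrite -(splitK c); case: (split c). Qed.

(** Lists the values of [s] on which [p] is defined. Dropping the others with [pmap] avoids a
    default element, so [X] may be empty. *)
Lemma finite_partial_image (X Z : Type) m (s : 'I_m -> Z) (p : Z -> option X) :
  exists n (v : 'I_n -> X), forall a x, p (s a) = Some x -> exists b, v b = x.
Proof.
pose l : seq {classic X} := pmap (fun a => p (s a) : option {classic X}) (enum 'I_m).
exists (size l), (tnth (in_tuple l)) => a x e.
have /tnthP [b ->] : (x : {classic X}) \in in_tuple l; last by exists b.
by rewrite mem_pmap; apply/mapP; exists a; rewrite ?mem_enum ?e.
Qed.

(** The left and the right values of [s] are listed separately, and [f] picks for each index a place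
    where its value occurs. It need not be a bijection, since terms are identified along every map
    of [aleph0]. *)
Lemma copair_factor (X Y : Type) k (s : 'I_k -> X + Y) :
  exists n m (v : 'I_n -> X) (w : 'I_m -> Y) (f : 'I_k -> 'I_(n + m)),
    forall a, copair v w (f a) = s a.
Proof.
have [n [v vP]] := finite_partial_image s (fun z => if z is inl x then Some x else None).
have [m [w wP]] := finite_partial_image s (fun z => if z is inr y then Some y else None).
have h a : exists c, copair v w c = s a.
  case e : (s a) => [x|y].
    have [|b <-] := vP a x; first by rewrite e.
    by exists (lshift m b); rewrite /copair sum_fun_l.
  have [|b <-] := wP a y; first by rewrite e.
  by exists (rshift n b); rewrite /copair sum_fun_r.
by exists n, m, v, w, (fun a => sval (cid (h a))) => a; exact: (svalP (cid (h a))).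
Qed.

(** * Additivity of the monad of a theory with biproducts *)

Section Additivity.

Variables (L : lawvere) (b : biproducts L).
Let E n m (f : nhom aleph0 n m) : nhom L n m := nmap (lemb L) f.

(** Naturality of the first projection, checked on the two coprojections: on the second one both
    sides are zero. *)
Lemma proj1_sum_map n m p q (f : 'I_n -> 'I_p) (g : 'I_m -> 'I_q) :
  proj1 b p q \on E (sum_map f g : nhom aleph0 _ _)
  = E (f : nhom aleph0 _ _) \on proj1 b n m.
Proof.
apply: lcoprod_ext; rewrite -!ncompA /kap1 /kap2 -nmapM.
  have -> : (sum_map f g : nhom aleph0 _ _) \on inj1 n m
          = inj1 p q \on (f : nhom aleph0 _ _).
    by apply: funext => a; exact: sum_fun_l.
  by rewrite nmapM ncompA bip11 bip11 n1comp ncomp1.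
have -> : (sum_map f g : nhom aleph0 _ _) \on inj2 n m
          = inj2 p q \on (g : nhom aleph0 _ _).
  by apply: funext => a; exact: sum_fun_r.
rewrite nmapM ncompA; apply: (is_zero_unique (bip_terminal b)).
  by apply: is_zero_compr; apply: bip12.
by apply: is_zero_compl; apply: bip12.
Qed.

Lemma proj2_sum_map n m p q (f : 'I_n -> 'I_p) (g : 'I_m -> 'I_q) :
  proj2 b p q \on E (sum_map f g : nhom aleph0 _ _)
  = E (g : nhom aleph0 _ _) \on proj2 b n m.
Proof.
apply: lcoprod_ext; rewrite -!ncompA /kap1 /kap2 -nmapM; last first.
  have -> : (sum_map f g : nhom aleph0 _ _) \on inj2 n m
          = inj2 p q \on (g : nhom aleph0 _ _).
    by apply: funext => a; exact: sum_fun_r.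
  by rewrite nmapM ncompA bip22 bip22 n1comp ncomp1.
have -> : (sum_map f g : nhom aleph0 _ _) \on inj1 n m
          = inj1 p q \on (f : nhom aleph0 _ _).
  by apply: funext => a; exact: sum_fun_l.
rewrite nmapM ncompA; apply: (is_zero_unique (bip_terminal b)).
  by apply: is_zero_compr; apply: bip21.
by apply: is_zero_compl; apply: bip21.
Qed.

Lemma biprod_ext k n m (f g : nhom L k (n + m)) :
  proj1 b n m \on f = proj1 b n m \on g -> proj2 b n m \on f = proj2 b n m \on g -> f = g.
Proof.
move=> e1 e2; have [h [_ hU]] := bip_product b (proj1 b n m \on g) (proj2 b n m \on g).
by rewrite -(hU f) // -(hU g).
Qed.

Definition TL_zero : TL L void :=
  cls (Term (zero_mor (bip_terminal b) 1 0)
    (fun i : 'I_0 => match notF (ltn_ord i) with end)).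

(** A positive arity would yield an argument in [void], so the arity is 0; a morphism from 1 to 0 is
    then the zero one. *)
Lemma TL_zeroE (t : TL L void) : t = TL_zero.
Proof.
move: t; apply: TL_ind => i g v; case: i g v => [|i] g v; last by case: (v ord0).
apply: clsE; last by case.
by apply: zero_morE; exists g, (nid 0); rewrite n1comp.
Qed.

(** The zero operation can be given any list [v] of arguments, hence the same list as the other
    terms in a join. *)
Lemma zero_map_TL (X Y : Sets) (x : X) n (v : 'I_n -> Y) :
  zero_map TL_zero Y x = cls (Term (zero_mor (bip_terminal b) 1 n) v).
Proof.
rewrite /zero_map /fmap /= TL_fmapE.
have -> : zero_mor (bip_terminal b) 1 n =
   E ((fun i : 'I_0 => match notF (ltn_ord i) with end) : nhom aleph0 0 n)
     \on zero_mor (bip_terminal b) 1 0.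
  apply/esym/zero_morE; apply: is_zero_compl.
  by exists (zero_mor (bip_terminal b) 1 0), (nid 0); rewrite n1comp.
by apply/esym; apply: cls_emb; case.
Qed.

Lemma ret_TL (X : Sets) n (v : 'I_n -> X) a :
  ret (v a) = cls (Term (E (pt a)) v) :> TL L X.
Proof. by apply/esym; rewrite -[E _]ncomp1; apply: cls_emb. Qed.

(** The equation [proj1 = [id, 0]], with the identity split into its points. *)
Lemma cotuple_proj1 n m :
  cotuple (sum_fun (fun a : 'I_n => E (pt a)) (fun=> zero_mor (bip_terminal b) 1 n))
  = proj1 b n m.
Proof.
apply: cotuple_uniq; apply: split_eq => a; rewrite ?sum_fun_l ?sum_fun_r.
  rewrite -(pt_comp (inj1 n m)) nmapM ncompA.
  by have := bip11 b n m; rewrite /kap1 => ->; rewrite n1comp.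
rewrite -(pt_comp (inj2 n m)) nmapM ncompA; apply: zero_morE.
by apply: is_zero_compr; apply: bip12.
Qed.

Lemma cotuple_proj2 n m :
  cotuple (sum_fun (fun=> zero_mor (bip_terminal b) 1 m) (fun a : 'I_m => E (pt a)))
  = proj2 b n m.
Proof.
apply: cotuple_uniq; apply: split_eq => a; rewrite ?sum_fun_l ?sum_fun_r; last first.
  rewrite -(pt_comp (inj2 n m)) nmapM ncompA.
  by have := bip22 b n m; rewrite /kap2 => ->; rewrite n1comp.
rewrite -(pt_comp (inj1 n m)) nmapM ncompA; apply: zero_morE.
by apply: is_zero_compr; apply: bip21.
Qed.

(** In the first component, variables from [X] become points of [v] and those from [Y] become zeros
    over the same [v]. The join is then composition with a cotuple, which is the projection; the
    second component is symmetric. *)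
Lemma bc_TL (X Y : Sets) n m (g : nhom L 1 (n + m)) (v : 'I_n -> X) (w : 'I_m -> Y) :
  bc TL_zero (cls (Term g (copair v w)) : TL L _)
  = (cls (Term (proj1 b n m \on g) v), cls (Term (proj2 b n m \on g) w)).
Proof.
rewrite /bc /join /fmap /= !TL_fmapE -cotuple_proj1 -cotuple_proj2; congr pair.
  apply: (@TL_join_common _ _ _ _ _ _
    (sum_fun (fun a : 'I_n => E (pt a)) (fun=> zero_mor (bip_terminal b) 1 n)) v).
  apply: split_eq => a /=; rewrite /copair ?sum_fun_l ?sum_fun_r /=.
    exact: ret_TL.
  exact: (zero_map_TL (w a) v).
apply: (@TL_join_common _ _ _ _ _ _
  (sum_fun (fun=> zero_mor (bip_terminal b) 1 m) (fun a : 'I_m => E (pt a))) w).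
apply: split_eq => a /=; rewrite /copair ?sum_fun_l ?sum_fun_r /=.
  exact: (zero_map_TL (v a) w).
exact: ret_TL.
Qed.

Lemma TL_copair (X Y : Sets) (t : TL L (X + Y)%type) :
  exists n m (g : nhom L 1 (n + m)) (v : 'I_n -> X) (w : 'I_m -> Y),
    t = cls (Term g (copair v w)).
Proof.
move: t; apply: TL_ind => i g s; have [n [m [v [w [f fs]]]]] := copair_factor s.
exists n, m, (E (f : nhom aleph0 _ _) \on g), v, w; apply/esym; exact: cls_emb.
Qed.

(* [teq_join] rewrites both components over common arguments s1 and s2; the
   operations then agree after both projections, hence are equal. *)
Lemma bc_TL_inj (X Y : Sets) : injective (@bc (TL L) TL_zero X Y).
Proof.
move=> t t'; have [n [m [g [v [w ->]]]]] := TL_copair t.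
have [n' [m' [g' [v' [w' ->]]]]] := TL_copair t'.
rewrite !bc_TL => e.
have /clsP/teq_join [[p u1 s1] [[f [f1 f2]] [f' [f1' f2']]]] := congr1 fst e.
have /clsP/teq_join [[q u2 s2] [[k [k1 k2]] [k' [k1' k2']]]] := congr1 snd e.
have {t t' e} copairE i j (x : 'I_i -> 'I_p) (y : 'I_j -> 'I_q) (h : nhom L 1 (i + j)) :
    cls (Term h (copair (s1 \o x) (s2 \o y)))
    = cls (Term (E (sum_map x y : nhom aleph0 _ _) \on h) (copair s1 s2)).
  apply/esym; apply: cls_emb; apply: split_eq => c;
  by rewrite /copair /sum_map /= ?sum_fun_l ?sum_fun_r /= ?sum_fun_l ?sum_fun_r.
move: f1 f2 f1' f2' k1 k2 k1' k2' => /= -> -> e1 -> -> -> e2 ->.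
rewrite (copairE _ _ f k) (copairE _ _ f' k').
congr (cls (Term _ _)); apply: biprod_ext.
  by rewrite !ncompA !proj1_sum_map -!ncompA -/(E _) e1.
by rewrite !ncompA !proj2_sum_map -!ncompA -/(E _) e2.
Qed.

Lemma bc_TL_surj (X Y : Sets) (p : TL L X * TL L Y) : exists t, bc TL_zero t = p.
Proof.
case: p => q q'; move: q q'; apply: TL_ind => n g v; apply: TL_ind => m h w.
(* The operation of the preimage is the pairing of [g] and [h] into the product [n + m]. *)
have [k [[kg kh] _]] := bip_product b g h.
by exists (cls (Term k (copair v w))); rewrite bc_TL kg kh.
Qed.

Lemma TL_additive : additive_monad (TL L).
Proof.
exists TL_zero; split=> [|X Y]; first exact: TL_zeroE.
by apply: inj_surj_bijective; [exact: bc_TL_inj | exact: bc_TL_surj].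
Qed.

End Additivity.

(** * The restricted functor *)

Definition TL_acmonad (L : smblaw) : acmonad :=
  @ACMonad (TL_cmonad L) (TL_additive (smblaw_bip L)).

Definition calT_additive : functor SMBLaw ACMnd :=
  @Functor SMBLaw ACMnd TL_acmonad (fun L L' F => @farr SMLaw CMnd calT _ _ (smbfun F))
    (fun L => farr1 calT (L : smlaw))
    (fun L L' L'' G F => farrM calT (smbfun G) (smbfun F)).

(** Objects and arrows agree by conversion; only the proofs of the functor laws differ. *)
Lemma calT_additiveE :
  functor_comp incl_ACMnd calT_additive = functor_comp calT forget_SMBLaw.
Proof. by congr Functor; apply: Prop_irrelevance. Qed.

(** * The unit of the adjunction *)

Section Unit.

Variable L : lawvere.
Let E n m (f : nhom aleph0 n m) : nhom L n m := nmap (lemb L) f.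

Definition unit_map n m (H : nhom L n m) (i : 'I_n) : TL L 'I_m :=
  cls (Term (H \on E (pt i)) id).

(** Coprojections and monoidal isomorphisms all come from [aleph0], so this one equation shows that
    the unit preserves them. *)
Lemma unit_emb n m (f : nhom aleph0 n m) : unit_map (E f) = nmap (Kl_emb (TL L)) f.
Proof.
by apply: funext => i; rewrite /unit_map -nmapM pt_comp; apply/esym; exact: (ret_TL L id).
Qed.

(** Once all results of [f] are written over a common argument list [s], substitution is composition
    with a cotuple. *)
Lemma bind_TL (X Y : Sets) i (g : nhom L 1 i) (v : 'I_i -> X) (f : X -> TL L Y)
    m (h : 'I_i -> nhom L 1 m) (s : 'I_m -> Y) :
  (forall a, f (v a) = cls (Term (h a) s)) ->
  bind (cls (Term g v) : TL L X) f = cls (Term (cotuple h \on g) s).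
Proof. by move=> e; rewrite /bind /join /fmap /= TL_fmapE; apply: TL_join_common. Qed.

Definition unit_natfunctor : natfunctor L (Kl_natcat (TL L)).
refine (@NatFunctor L (Kl_natcat (TL L)) unit_map _ _).
- by move=> n; rewrite -(nmap1 (lemb L)) unit_emb nmap1.
- move=> n m p g f; apply: funext => i; apply/esym.
  apply: etrans (bind_TL (h := fun a => g \on E (pt a)) (s := id) _ _) _ => //.
  by rewrite (@cotuple_uniq _ _ _ _ g) // ncompA.
Defined.

Definition unit_law_hom : law_hom L (Kl_lawvere (TL L)) :=
  @LawHom L (Kl_lawvere (TL L)) unit_natfunctor
    (fun n m => unit_emb (inj1 n m)) (fun n m => unit_emb (inj2 n m)).

End Unit.

Lemma unit_tens (L : smlaw) n m p q (f : nhom L n p) (g : nhom L m q) :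
  unit_map (tens (smlaw_tens L) f g)
  = @Kl_tens (TL_cmonad L) _ _ _ _ (unit_map f) (unit_map g).
Proof.
apply: co_ext => a b; rewrite Kl_tensE /unit_map; apply/esym.
apply: etrans (bind_TL (h := fun x : 'I_p =>
    nmap (lemb L) ((fun y : 'I_q => unco (x, y)) : nhom aleph0 _ _)
      \on (g \on nmap (lemb L) (pt b))) (s := id) _ _) _.
  by move=> x; rewrite -fmapE /fmap /= TL_fmapE; apply/esym; apply: cls_emb.
(* [cotuple_r] recognises the substitution as the tensor of [f] at [a] and [g] at [b]. Interchange
   pulls out the tensor of [f] and [g], and what remains in [aleph0] is the point [unco (a, b)]. *)
rewrite cotuple_r -tensM ncomp1 n1comp tensM -(strict_tens (smlawP L)).
by rewrite -ncompA -nmapM; congr (cls (Term (_ \on nmap _ _) _)).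
Qed.

Definition unit_smlaw_hom (L : smlaw) : smlaw_hom L (Kl_smlaw (TL_cmonad L)).
refine (@SMLawHom L (Kl_smlaw (TL_cmonad L)) (unit_law_hom L) _).
split; first exact: unit_tens.
- by move=> n m p; rewrite -(strict_assoc (smlawP L)); apply: unit_emb.
- by move=> n; rewrite -(strict_lunit (smlawP L)); apply: unit_emb.
- by move=> n; rewrite -(strict_runit (smlawP L)); apply: unit_emb.
- by move=> n m; rewrite -(strict_braid (smlawP L)); apply: unit_emb.
Defined.

Definition unit_smblaw_hom (L : smblaw) : smblaw_hom L (Kl_smblaw (TL_acmonad L)) :=
  @SMBLawHom L (Kl_smblaw (TL_acmonad L)) (unit_smlaw_hom L)
    (law_hom_proj1 (smblaw_bip L) (Kl_biproducts (TL_acmonad L)) (unit_law_hom L))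
    (law_hom_proj2 (smblaw_bip L) (Kl_biproducts (TL_acmonad L)) (unit_law_hom L)).

(** Gives naturality of the adjunction bijection in the theory. *)
Lemma unit_natural (L L' : smblaw) (F : smblaw_hom L L') :
  @compc SMBLaw _ _ _ (farr KlN (farr calT_additive F)) (unit_smblaw_hom L)
  = @compc SMBLaw _ _ _ (unit_smblaw_hom L') F.
Proof.
apply: smblaw_hom_ext; apply: smlaw_hom_ext => n m H; apply: funext => i /=.
by rewrite /unit_map TL_mmapE nmapM law_hom_emb.
Qed.

(** * Transposes and their uniqueness *)

Section Transpose.

Variables (L : lawvere) (B : monad) (G : law_hom L (Kl_lawvere B)).

Definition term_eval (X : Sets) (r : term L X) : B X :=
  fmap (args r) (nmap G (op r) ord0).

(** [G] sends an embedded [f] to the pure Kleisli map of [f], so moving [f] from the operation to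
    the arguments is functoriality of [fmap]. *)
Lemma term_eval_teq (X : Sets) (r s : term L X) : teq r s -> term_eval r = term_eval s.
Proof.
elim=> {r s} [_ _ [i m f g v]|//|r s _ -> //|r s t _ -> _ -> //].
rewrite /term_eval /= nmapM law_hom_emb fmap_comp; congr fmap.
by rewrite fmapE.
Qed.

Definition TL_eval (X : Sets) (q : TL_obj L X) : B X := term_eval (Defs.repr q).

Lemma TL_evalE (X : Sets) i (g : nhom L 1 i) (v : 'I_i -> X) :
  TL_eval (cls (Term g v)) = fmap v (nmap G g ord0).
Proof. by apply: (@term_eval_teq _ _ (Term g v)); apply/clsP; rewrite Defs.reprK. Qed.

(** Reduces the components of a Kleisli map out of [n] to maps out of 1, whose only index is
    [ord0]. *)
Lemma law_hom_pt n m (H : nhom L n m) a :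
  nmap G (H \on nmap (lemb L) (pt a)) ord0 = nmap G H a.
Proof. by rewrite nmapM law_hom_emb; apply: bind_retl. Qed.

Definition transpose : monad_map (TL L) B.
refine (@MonadMap (TL L) B TL_eval _ _ _).
- move=> X Y f; apply: TL_ind => i g v.
  by rewrite {1}/fmap /= TL_fmapE !TL_evalE fmap_comp.
- move=> X x; rewrite {1}/ret /= /TL_ret TL_evalE nmap1; exact: ret_nat.
- move=> X; apply: TL_ind => i g q; have [m [h [s hs]]] := TL_common q.
  rewrite {1}/join /= (TL_join_common _ hs) !TL_evalE nmapM -fmap_comp.
  (* Both sides bind [nmap G g ord0]. At index [a] the component of [nmap G (cotuple h)] is
     [nmap G (h a) ord0]. *)
  apply: etrans (join_nat _ _) _; rewrite -fmap_comp; apply: eq_bind => a /=.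
  by rewrite hs TL_evalE -(law_hom_pt (cotuple h)) cotupleE.
Defined.

Lemma transpose_unit n m (H : nhom L n m) i : mmap transpose (unit_map H i) = nmap G H i.
Proof. by rewrite /= TL_evalE fmap_id law_hom_pt. Qed.

Lemma transpose_unique (s : monad_map (TL L) B) :
  (forall n m (H : nhom L n m) i, mmap s (unit_map H i) = nmap G H i) -> s = transpose.
Proof.
move=> e; apply: monad_map_ext => X; apply: TL_ind => i g v.
rewrite /= TL_evalE -e -mmap_nat; congr mmap.
by rewrite /fmap /= /unit_map TL_fmapE pt1 nmap1 ncomp1.
Qed.

End Transpose.

Theorem lemma21 :
  exists T : functor SMBLaw ACMnd,
    functor_comp incl_ACMnd T = functor_comp calT forget_SMBLaw /\
    is_left_adjoint T KlN.
Proof.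
exists calT_additive; split; first exact: calT_additiveE.
exists (fun (L : SMBLaw) (B : ACMnd) f =>
  @compc SMBLaw _ _ _ (farr KlN f) (unit_smblaw_hom L)); split.
  move=> L B; exists (fun G : smblaw_hom L (Kl_smblaw B) => transpose G).
    (* A monad map is the transpose of its own composite with the unit. *)
    by move=> s; apply/esym; apply: transpose_unique.
  move=> G; apply: smblaw_hom_ext; apply: smlaw_hom_ext => n m H.
  by apply: funext => i; apply: transpose_unit.
by move=> L L' B B' h k f; rewrite !farrM -!compcA unit_natural.
Qed.
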